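(* Let $(\mathbf v^n,p^n,\mathbf Q^n,\mathbf H^n)$, $n=0,\dots,N_t$, be a solution of the SGE-BDF1 scheme (defined in the context) with time step $\tau>0$ and stabilization parameter $\kappa>0$, and let $M>0$ be such that $|\mathbf Q^n(\mathbf x)|\le M$ for all $n=0,\dots,N_t$ and all $\mathbf x\in\overline\Omega$. Suppose that $\kappa$ is large enough that the functional $$F_\kappa(\mathbf Q)=\tfrac{\kappa}{2}\|\mathbf Q\|^2-F_{\rm bulk}(\mathbf Q)$$ is convex on the set of $\mathcal M_0$-valued fields $\mathbf Q$ with $|\mathbf Q(\mathbf x)|\le M$ for all $\mathbf x\in\overline\Omega$. Define $$E^n_{\rm BDF1}=\int_\Omega\Big[\tfrac12|\mathbf v^n|^2+\tfrac{K}{2}|\nabla\mathbf Q^n|^2+\tfrac{W}{2}|\mathbf Q^n-\mathbf Q_\star|^2\Big]d\mathbf x+F_{\rm bulk}(\mathbf Q^n).$$ Then for every $0\le n\le N_t-1$, $$\begin{aligned}E^{n+1}_{\rm BDF1}-E^n_{\rm BDF1}\le{}&-2\tau\|\sqrt{\eta}\,\mathbf D^{n+1}\|^2-\tau\|\sqrt b\,\mathbf v^{n+1}\|^2-\tau\|\sqrt{\Gamma_{\mathbf Q}}\,\mathbf H^{n+1}\|^2\\&-\tfrac12\|\mathbf v^{n+1}-\mathbf v^n\|^2-\tfrac12\|\sqrt K\,\nabla(\mathbf Q^{n+1}-\mathbf Q^n)\|^2+\tau(\mathbf Q^n,\chi\mathbf D^{n+1}-\xi\mathbf H^{n+1}).\end{aligned}$$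 In particular, in the passive case $\chi=\xi=0$ the scheme is energy stable: $E^{n+1}_{\rm BDF1}\le E^n_{\rm BDF1}$ for all $0\le n\le N_t-1$.
   Context: Notation. $d\in\{2,3\}$, $\Omega\subset\mathbb R^d$ is a square (cubic) domain with outward normal $\mathbf n$. $\mathcal M_0$ is the space of real symmetric trace-free $d\times d$ matrices. $\mathbf P:\mathbf Q=\mathrm{tr}(\mathbf P^\top\mathbf Q)$, $|\mathbf Q|^2=\mathbf Q:\mathbf Q$; $(\cdot,\cdot)$ and $\|\cdot\|$ are the $L^2(\Omega)$ inner product and norm for scalar, vector and tensor fields. $[\nabla\mathbf v]_{ij}=\partial_jv_i$, $\mathbf D(\mathbf v)=\frac12(\nabla\mathbf v+\nabla\mathbf v^\top)$, $\boldsymbol\Omega(\mathbf v)=\frac12(\nabla\mathbf v-\nabla\mathbf v^\top)$, $\mathbf D^n=\mathbf D(\mathbf v^n)$; $[\nabla\cdot\boldsymbol\tau]_i=\partial_j\tau_{ij}$; $[\nabla\cdot(K\nabla\mathbf Q)]_{ij}=\partial_k(K\partial_kQ_{ij})$; $(\mathbf v\cdot\nabla\mathbf Q)_{ij}=v_k\partial_kQ_{ij}$; $(\mathbf H:\nabla\mathbf Q)_k=H_{ij}\partial_kQ_{ij}$. A dot between matrices is the matrix product. All fields are assumed regular enough for the formulas and integrations by parts to make sense. Coefficients. $\phi:\overline\Omega\to[0,1]$ is a prescribed time-independent function and $b=b_{solid}(1-\phi)\ge0$, $\eta=\eta_{fluid}\phi+\eta_{solid}(1-\phi)\ge0$, $\xi=\xi_{fluid}\phi$,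 $\chi=\chi_{fluid}\phi$, $K=K_{fluid}\phi\ge0$, $\Gamma_{\mathbf Q}=\Gamma_{fluid}\phi+\Gamma_{solid}(1-\phi)\ge0$, $W=W_0|\nabla\phi|\ge0$, $N=N_{fluid}\phi+N_{solid}(1-\phi)\ge0$, $\alpha=A(1-N/3)$, $\beta=\gamma=AN$ with a constant $A>0$; $a\in\mathbb R$ is a constant; $\xi_{fluid},\chi_{fluid}\in\mathbb R$ (activity). $\mathbf Q_\star$ is a given $\mathcal M_0$-valued field. Bulk energy. $F_{\rm bulk}(\mathbf Q)=\int_\Omega[\frac\alpha2\mathrm{tr}(\mathbf Q^2)-\frac\beta3\mathrm{tr}(\mathbf Q^3)+\frac\gamma4(\mathrm{tr}(\mathbf Q^2))^2]d\mathbf x$ and $f_{\rm bulk}(\mathbf Q)=\alpha\mathbf Q-\beta(\mathbf Q^2-\frac{\mathrm{tr}(\mathbf Q^2)}{d}\mathbf I)+\gamma\,\mathrm{tr}(\mathbf Q^2)\mathbf Q$. Explicit terms. $\mathbf g_{\mathbf v}^n=\mathbf v^n$, $\mathbf G_{\mathbf Q}^n=-\mathbf H^n$, $\mathbf c_{\mathbf v}^n=-\mathbf v^n\cdot\nabla\mathbf v^n+\nabla\cdot\boldsymbol\Sigma^n-\mathbf H^n:\nabla\mathbf Q^n$, $\mathbf C_{\mathbf Q}^n=-\mathbf v^n\cdot\nabla\mathbf Q^n+\mathbf S^n$, $\mathbf f_{\mathbf v}^n=-\nabla\cdot(\chi\mathbf Q^n)$, $\mathbf F_{\mathbf Q}^n=\xi\mathbf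 Q^n$, where, at time level $n$, $\boldsymbol\Sigma=\mathbf Q\cdot\mathbf H-\mathbf H\cdot\mathbf Q-a(\mathbf Q\cdot\mathbf H+\mathbf H\cdot\mathbf Q)-\frac{2a}{d}\mathbf H+2a(\mathbf Q:\mathbf H)(\mathbf Q+\frac1d\mathbf I)$ and $\mathbf S=\boldsymbol\Omega\cdot\mathbf Q-\mathbf Q\cdot\boldsymbol\Omega+a(\mathbf Q\cdot\mathbf D+\mathbf D\cdot\mathbf Q)+\frac{2a}{d}\mathbf D-2a(\mathbf D:\mathbf Q)(\mathbf Q+\frac1d\mathbf I)$. $\mathcal G(\mathbf g,\mathbf G)=\|\mathbf g\|^2+\|\mathbf G\|^2$. SGE-BDF1 scheme. Given $\mathbf v^0$ (divergence free) and $\mathbf Q^0$ ($\mathcal M_0$-valued), with $\mathbf H^0=\nabla\cdot(K\nabla\mathbf Q^0)-f_{\rm bulk}(\mathbf Q^0)-W(\mathbf Q^0-\mathbf Q_\star)$, for $n=0,\dots,N_t-1$ the fields $\mathbf v^{n+1},p^{n+1}$, the $\mathcal M_0$-valued field $\mathbf Q^{n+1}$, and scalars $\zeta^{n+1},\omega^{n+1}$ satisfy $$\tfrac{\mathbf v^{n+1}-\mathbf v^n}{\tau}=-\nabla p^{n+1}+2\nabla\cdot(\eta\mathbf D^{n+1})-b\mathbf v^{n+1}+\zeta^{n+1}\mathbf c_{\mathbf v}^n-\omega^{n+1}\mathbf g_{\mathbf v}^n+\mathbf f_{\mathbf v}^n,\qquad\nabla\cdot\mathbf v^{n+1}=0,$$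 $$\tfrac{\mathbf Q^{n+1}-\mathbf Q^n}{\tau}=\Gamma_{\mathbf Q}\mathbf H^{n+1}+\zeta^{n+1}\mathbf C_{\mathbf Q}^n-\omega^{n+1}\mathbf G_{\mathbf Q}^n+\mathbf F_{\mathbf Q}^n,$$ $$\zeta^{n+1}=\tfrac{(\mathbf g_{\mathbf v}^{n+1},\mathbf g_{\mathbf v}^n)+(\mathbf G_{\mathbf Q}^{n+1},\mathbf G_{\mathbf Q}^n)}{\mathcal G(\mathbf g_{\mathbf v}^n,\mathbf G_{\mathbf Q}^n)},\qquad\omega^{n+1}=\tfrac{(\mathbf g_{\mathbf v}^{n+1},\mathbf c_{\mathbf v}^n)+(\mathbf G_{\mathbf Q}^{n+1},\mathbf C_{\mathbf Q}^n)}{\mathcal G(\mathbf g_{\mathbf v}^n,\mathbf G_{\mathbf Q}^n)},$$ $$\mathbf H^{n+1}=\nabla\cdot(K\nabla\mathbf Q^{n+1})-W(\mathbf Q^{n+1}-\mathbf Q_\star)-\kappa(\mathbf Q^{n+1}-\mathbf Q^n)-f_{\rm bulk}(\mathbf Q^n),$$ with boundary conditions $\mathbf v^n|_{\partial\Omega}=0$ and, for all $n$, either $\mathbf Q^n|_{\partial\Omega}=\mathbf Q_D$ (fixed, $\mathcal M_0$-valued) or $\partial_{\mathbf n}\mathbf Q^n|_{\partial\Omega}=0$. It is assumed that $\mathcal G(\mathbf g_{\mathbf v}^n,\mathbf G_{\mathbf Q}^n)\ne0$ at every step. *)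

(* Defs.v *)
From HB Require Import structures.
From mathcomp Require Export all_boot all_order all_algebra.
From mathcomp Require Export all_classical all_reals all_analysis.
Export Order.TTheory GRing.Theory Num.Theory.
Export numFieldNormedType.Exports.

Set Implicit Arguments.
Unset Strict Implicit.
Unset Printing Implicit Defensive.

Local Open Scope classical_set_scope.
Local Open Scope ring_scope.

Section Calculus.
Context {R : realType} {d : nat}.
Implicit Types (x : 'rV[R]_d) (k : 'I_d).

Definition point_of_seq (s : seq R) : 'rV[R]_d := \row_(i < d) s`_i.

(* Lebesgue integral over a subset of R^d, for the product Lebesgue measure on
   R * R or R * R * R; only d = 2 and d = 3 are meaningful. *)
Definition lebesgue_int (A : set 'rV[R]_d) (f : 'rV[R]_d -> R) : R :=
  let mu := @lebesgue_measure R in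
  match d with
  | 2 => let e (z : R * R) := point_of_seq [:: z.1; z.2] in
      (\int[(mu \x mu)%E]_(z in e @^-1` A) f (e z))%R
  | 3 => let e (z : R * R * R) := point_of_seq [:: z.1.1; z.1.2; z.2] in
      (\int[((mu \x mu) \x mu)%E]_(z in e @^-1` A) f (e z))%R
  | _ => 0
  end.

Definition pd {V : normedModType R} k (f : 'rV[R]_d -> V) x : V :=
  'D_(delta_mx 0 k) f x.

(* P : Q for matrices; for row vectors this is the Euclidean inner product. *)
Definition ddot {m n : nat} (P Q : 'M[R]_(m, n)) : R := \tr (P^T *m Q).

Definition sqnorm {m n : nat} (P : 'M[R]_(m, n)) : R := ddot P P.

Definition tnorm {m n : nat} (P : 'M[R]_(m, n)) : R := Num.sqrt (sqnorm P).

Definition grad (f : 'rV[R]_d -> R) x : 'rV[R]_d := \row_k pd k f x.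

Definition vgrad (v : 'rV[R]_d -> 'rV[R]_d) x : 'M[R]_d :=
  \matrix_(i, j) pd j (fun y => v y 0 i) x.

Definition symgrad (v : 'rV[R]_d -> 'rV[R]_d) x : 'M[R]_d :=
  2^-1 *: (vgrad v x + (vgrad v x)^T).

Definition skewgrad (v : 'rV[R]_d -> 'rV[R]_d) x : 'M[R]_d :=
  2^-1 *: (vgrad v x - (vgrad v x)^T).

Definition vdiv (v : 'rV[R]_d -> 'rV[R]_d) x : R :=
  \sum_k pd k (fun y => v y 0 k) x.

Definition tdiv (T : 'rV[R]_d -> 'M[R]_d) x : 'rV[R]_d :=
  \row_i \sum_j pd j (fun y => T y i j) x.

Definition div_Kgrad (K : 'rV[R]_d -> R) (Q : 'rV[R]_d -> 'M[R]_d) x :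
    'M[R]_d :=
  \sum_k pd k (fun y => K y *: pd k Q y) x.

Definition advect {V : normedModType R} (v : 'rV[R]_d -> 'rV[R]_d)
    (f : 'rV[R]_d -> V) x : V :=
  \sum_k v x 0 k *: pd k f x.

Definition ddot_grad (H Q : 'rV[R]_d -> 'M[R]_d) x : 'rV[R]_d :=
  \row_k ddot (H x) (pd k Q x).

Definition M0 : set 'M[R]_d := [set P | P^T = P /\ \tr P = 0].

End Calculus.

Section Domain.
Context {R : realType} {d : nat}.

(* The domain is the axis-parallel open cube with lowest corner [corner] and
   edge length [side]. *)
Record model := Model {
  corner : 'rV[R]_d;
  side : R;
  phi : 'rV[R]_d -> R;
  b_solid : R;
  eta_fluid : R;
  eta_solid : R;
  xi_fluid : R;
  chi_fluid : R;
  K_fluid : R;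
  Gamma_fluid : R;
  Gamma_solid : R;
  W_0 : R;
  N_fluid : R;
  N_solid : R;
  A_bulk : R;
  a_flow : R;
  Q_star : 'rV[R]_d -> 'M[R]_d }.

Variable m : model.
Implicit Types (x : 'rV[R]_d).

Definition Omega : set 'rV[R]_d :=
  [set x | forall i, corner m 0 i < x 0 i < corner m 0 i + side m].

Definition closed_Omega : set 'rV[R]_d :=
  [set x | forall i, corner m 0 i <= x 0 i <= corner m 0 i + side m].

Definition bd_Omega : set 'rV[R]_d := closed_Omega `\` Omega.

(* [nu] is the outward unit normal at the boundary point [x]; it is defined in
   the relative interiors of the faces only, i.e. not on edges and corners. *)
Definition outward_normal x (nu : 'rV[R]_d) : Prop :=
  exists2 k : 'I_d,
    forall i, i != k -> corner m 0 i < x 0 i < corner m 0 i + side m &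
    (x 0 k = corner m 0 k + side m /\ nu = delta_mx 0 k) \/
    (x 0 k = corner m 0 k /\ nu = - delta_mx 0 k).

(* C^1 and C^2 regularity up to the boundary: on an open neighbourhood of the
   closed cube. *)
Definition C1 {V : normedModType R} (f : 'rV[R]_d -> V) : Prop :=
  exists U : set 'rV[R]_d, [/\ open U, closed_Omega `<=` U &
    forall x, U x ->
      differentiable f x /\ forall k, {for x, continuous (pd k f)}].

Definition C2 {V : normedModType R} (f : 'rV[R]_d -> V) : Prop :=
  C1 f /\ forall k, C1 (pd k f).

Definition int_Omega (f : 'rV[R]_d -> R) : R := lebesgue_int Omega f.

Definition inner {p q : nat} (P Q : 'rV[R]_d -> 'M[R]_(p, q)) : R :=
  int_Omega (fun x => ddot (P x) (Q x)).

Definition normL2 {p q : nat} (P : 'rV[R]_d -> 'M[R]_(p, q)) : R :=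
  Num.sqrt (inner P P).

(* L^2 norm of the third-order tensor field k |-> T k *)
Definition normL2_3 {p q : nat} (T : 'I_d -> 'rV[R]_d -> 'M[R]_(p, q)) : R :=
  Num.sqrt (int_Omega (fun x => \sum_k sqnorm (T k x))).

Definition coef_b x : R := b_solid m * (1 - phi m x).
Definition coef_eta x : R :=
  eta_fluid m * phi m x + eta_solid m * (1 - phi m x).
Definition coef_xi x : R := xi_fluid m * phi m x.
Definition coef_chi x : R := chi_fluid m * phi m x.
Definition coef_K x : R := K_fluid m * phi m x.
Definition coef_Gamma x : R :=
  Gamma_fluid m * phi m x + Gamma_solid m * (1 - phi m x).
Definition coef_W x : R := W_0 m * tnorm (grad (phi m) x).
Definition coef_N x : R := N_fluid m * phi m x + N_solid m * (1 - phi m x).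
Definition coef_alpha x : R := A_bulk m * (1 - coef_N x / 3).
Definition coef_beta x : R := A_bulk m * coef_N x.
Definition coef_gamma x : R := A_bulk m * coef_N x.

Definition model_assumptions : Prop :=
  [/\ 0 < side m /\ 0 < A_bulk m,
      C1 (phi m : 'rV[R]_d -> R^o),
      forall x, closed_Omega x -> 0 <= phi m x <= 1,
      forall x, closed_Omega x ->
        [/\ 0 <= coef_b x, 0 <= coef_eta x, 0 <= coef_K x, 0 <= coef_Gamma x
          & 0 <= coef_W x /\ 0 <= coef_N x]
    & {within closed_Omega, continuous (Q_star m)} /\
      (forall x, closed_Omega x -> M0 (Q_star m x))].

Definition F_bulk (Q : 'rV[R]_d -> 'M[R]_d) : R :=
  int_Omega (fun x =>
    coef_alpha x / 2 * \tr (Q x *m Q x)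
    - coef_beta x / 3 * \tr (Q x *m Q x *m Q x)
    + coef_gamma x / 4 * (\tr (Q x *m Q x)) ^+ 2).

Definition f_bulk (Q : 'rV[R]_d -> 'M[R]_d) x : 'M[R]_d :=
  coef_alpha x *: Q x
  - coef_beta x *: (Q x *m Q x - (\tr (Q x *m Q x) / d%:R)%:M)
  + (coef_gamma x * \tr (Q x *m Q x)) *: Q x.

Definition F_kappa (kappa : R) (Q : 'rV[R]_d -> 'M[R]_d) : R :=
  kappa / 2 * normL2 Q ^+ 2 - F_bulk Q.

(* The regularity class is that of the discrete solution; a smaller class makes
   a convexity hypothesis on this set weaker. *)
Definition M0_fields_bounded_by (M : R) : set ('rV[R]_d -> 'M[R]_d) :=
  [set Q | C2 Q /\ forall x, closed_Omega x -> M0 (Q x) /\ tnorm (Q x) <= M].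

End Domain.

Arguments model : clear implicits.

Section Scheme.
Context {R : realType} {d : nat}.
Variable m : model R d.

Record state := State {
  vel : 'rV[R]_d -> 'rV[R]_d;
  pres : 'rV[R]_d -> R;
  Qten : 'rV[R]_d -> 'M[R]_d;
  Hten : 'rV[R]_d -> 'M[R]_d }.

Implicit Types (s : state) (x : 'rV[R]_d).

Definition Sigma s x : 'M[R]_d :=
  let a := a_flow m in let Q := Qten s x in let H := Hten s x in
  Q *m H - H *m Q - a *: (Q *m H + H *m Q) - (2 * a / d%:R) *: H
  + (2 * a * ddot Q H) *: (Q + (d%:R^-1)%:M).

Definition Sten s x : 'M[R]_d :=
  let a := a_flow m in let Q := Qten s x in
  let D := symgrad (vel s) x in let O := skewgrad (vel s) x in
  O *m Q - Q *m O + a *: (Q *m D + D *m Q) + (2 * a / d%:R) *: D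
  - (2 * a * ddot D Q) *: (Q + (d%:R^-1)%:M).

Definition g_v s x : 'rV[R]_d := vel s x.
Definition G_Q s x : 'M[R]_d := - Hten s x.
Definition c_v s x : 'rV[R]_d :=
  - advect (vel s) (vel s) x + tdiv (Sigma s) x - ddot_grad (Hten s) (Qten s) x.
Definition C_Q s x : 'M[R]_d := - advect (vel s) (Qten s) x + Sten s x.
Definition f_v s x : 'rV[R]_d := - tdiv (fun y => coef_chi m y *: Qten s y) x.
Definition F_Q s x : 'M[R]_d := coef_xi m x *: Qten s x.

Definition calG s : R := normL2 m (g_v s) ^+ 2 + normL2 m (G_Q s) ^+ 2.

Definition initial_state s : Prop :=
  forall x, Omega m x ->
    vdiv (vel s) x = 0 /\
    Hten s x = div_Kgrad (coef_K m) (Qten s) x - f_bulk m (Qten s) x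
               - coef_W m x *: (Qten s x - Q_star m x).

Definition scheme_step (tau kappa zeta' omega' : R) s s' : Prop :=
  [/\ forall x, Omega m x ->
        [/\ tau^-1 *: (vel s' x - vel s x) =
              - grad (pres s') x
              + 2 *: tdiv (fun y => coef_eta m y *: symgrad (vel s') y) x
              - coef_b m x *: vel s' x
              + zeta' *: c_v s x - omega' *: g_v s x + f_v s x,
            vdiv (vel s') x = 0,
            tau^-1 *: (Qten s' x - Qten s x) =
              coef_Gamma m x *: Hten s' x
              + zeta' *: C_Q s x - omega' *: G_Q s x + F_Q s x
          & Hten s' x =
              div_Kgrad (coef_K m) (Qten s') x
              - coef_W m x *: (Qten s' x - Q_star m x)
              - kappa *: (Qten s' x - Qten s x) - f_bulk m (Qten s) x],
      zeta' = (inner m (g_v s') (g_v s) + inner m (G_Q s') (G_Q s)) / calG s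
    & omega' = (inner m (g_v s') (c_v s) + inner m (G_Q s') (C_Q s)) / calG s].

(* The type of boundary condition (Dirichlet or Neumann) is the same for all
   time levels. *)
Definition boundary_conditions (Nt : nat) (u : nat -> state) : Prop :=
  (forall n x, (n <= Nt)%N -> bd_Omega m x -> vel (u n) x = 0) /\
  ((exists2 Q_D : 'rV[R]_d -> 'M[R]_d,
      forall x, bd_Omega m x -> M0 (Q_D x) &
      forall n x, (n <= Nt)%N -> bd_Omega m x -> Qten (u n) x = Q_D x) \/
   (forall n x nu, (n <= Nt)%N -> outward_normal m x nu ->
      'D_nu (Qten (u n)) x = 0)).

(* There is no initial pressure: [pres (u 0)] and [zeta 0], [omega 0] are
   unconstrained. *)
Definition SGE_BDF1 (Nt : nat) (tau kappa : R) (u : nat -> state)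
    (zeta omega : nat -> R) : Prop :=
  [/\ forall n, (n <= Nt)%N ->
        [/\ C2 m (vel (u n)), C2 m (Qten (u n)), C1 m (Hten (u n))
          & forall x, closed_Omega m x -> M0 (Qten (u n) x)],
      forall n, (n < Nt)%N -> C1 m (pres (u n.+1) : 'rV[R]_d -> R^o),
      boundary_conditions Nt u,
      initial_state (u 0)
    & forall n, (n < Nt)%N ->
        calG (u n) != 0 /\
        scheme_step tau kappa (zeta n.+1) (omega n.+1) (u n) (u n.+1)].

Definition E_BDF1 s : R :=
  int_Omega m (fun x =>
    2^-1 * sqnorm (vel s x)
    + coef_K m x / 2 * (\sum_k sqnorm (pd k (Qten s) x))
    + coef_W m x / 2 * sqnorm (Qten s x - Q_star m x))
  + F_bulk m (Qten s).

End Scheme.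

Arguments state : clear implicits.

(* Main.v *)
(* Test the momentum equation with [v'] and the tensor equation with [- H'],
   where primes denote level n+1.  The explicit nonlinear terms cancel by the
   choice of the two scalars, the pressure drops out because [v'] is divergence
   free, and [2 (a, a - b) = |a|^2 - |b|^2 + |a - b|^2] turns the implicit terms
   into differences of energies plus numerical dissipation.  Only the bulk term
   is explicit: convexity of [kappa/2 |Q|^2 - F_bulk Q] on the segment from [Q]
   to [Q'], along which this functional is a quartic polynomial, gives
   [F_bulk Q' - F_bulk Q <= (f_bulk Q, Q' - Q) + kappa/2 |Q' - Q|^2].

   All integrals are over an open cube and all integrands are continuous and
   bounded there, hence integrable; integration by parts is Fubini's theorem
   and the fundamental theorem of calculus on each line parallel to an axis. *)

Require Import Defs.
From HB Require Import structures.
From mathcomp Require Import measurable_realfun ring lra.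

Set Implicit Arguments.
Unset Strict Implicit.
Unset Printing Implicit Defensive.

Local Open Scope classical_set_scope.
Local Open Scope ring_scope.

(** * Measurability in coordinates *)

(** The cancellation of the explicit terms is a cross-multiplication: once tested, they give
    [zeta * B - omega * A], where [A] and [B] are the numerators of [zeta] and [omega], and the two
    quotients share their denominator. The test field [- H'] is the variational derivative of the
    energy, up to the time lag in the bulk term and the stabilization. The stabilization yields
    [kappa |Q' - Q|^2], and the bulk estimate costs half of it.

    Convexity is known for the integrated functional only. The first-order inequality is therefore
    read off from the coefficients of a real polynomial in [t], each of them an integral, and
    nothing is differentiated under the integral sign.

    Normals exist only inside the faces. This is enough, because an axis-parallel line through the
    open cube meets the boundary inside two opposite faces.

    Two classes of scalar functions organise the analysis: [bounded_continuous] for integrability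
    and [partially_C1] for integration by parts. [coef_W] and the entries of [Q_star] are only shown
    to be in the first; they are never differentiated. *)

Section CoordinateMeasurability.
Context {disp : measure_display} {T : measurableType disp} {R : realType}.
Context {d : nat} (e : T -> 'rV[R]_d).
Context (me : forall i, measurable_fun setT (fun z => e z 0 i)).

(** Balls of ['rV[R]_d] are sup-norm cubes, hence finite intersections of coordinate slabs. *)
Lemma measurable_preimage_ball (q : 'rV[R]_d) (r : R) :
  0 < r -> measurable (e @^-1` ball q r).
Proof.
move=> r0.
have -> : e @^-1` ball q r =
    \bigcap_(i in [set: 'I_d]) ((fun z => e z 0 i) @^-1` ball (q 0 i) r).
  apply/seteqP; split => z /=.
    by move=> [_ H] i _; exact: H.
  move=> H; split => // i j; rewrite ord1; exact: (H j).
apply: fin_bigcap_measurable => // i _; rewrite -[X in measurable X]setTI.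
by apply: me => //; apply: measurable_realfun.open_measurable; exact: ball_open.
Qed.

(** Second countability: [U] is the union of the countably many balls with rational centre and
    radius [1 / (n + 1)] that it contains. *)
Lemma measurable_preimage_open (U : set 'rV[R]_d) :
  open U -> measurable (e @^-1` U).
Proof.
move=> oU.
pose B (qn : 'rV[rat]_d * nat) : set 'rV[R]_d :=
  ball (map_mx ratr qn.1 : 'rV[R]_d) qn.2.+1%:R^-1.
pose F qn := if `[< B qn `<=` U >] then e @^-1` B qn else set0.
have -> : e @^-1` U = \bigcup_qn F qn.
  apply/seteqP; split => z /=; last first.
    by move=> [qn _]; rewrite /F; case: asboolP => // + Bz => /(_ _ Bz).
  move=> Uz; have /nbhs_ballP[r /= r0 rU] := open_nbhs_nbhs (conj oU Uz).
  (* A radius below [r / 2]: any ball of this radius that contains [e z] lies within distance [r] of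
     [e z], hence in [U]. *)
  have [n] := ltr_add_invr (divr_gt0 r0 (ltr0n R 2)); rewrite add0r => nr.
  set s := n.+1%:R^-1 in nr; have s0 : 0 < s by rewrite invr_gt0.
  have /choice[q qP] (j : 'I_d) :
      exists qj : rat, ratr qj \in `]e z 0 j - s, e z 0 j + s[.
    by apply: rat_in_itvoo; rewrite ltrD2l gtrN.
  have qz : ball (map_mx ratr (\row_j q j) : 'rV[R]_d) s (e z).
    split=> // i j; rewrite ord1 !mxE.
    rewrite /ball /= ltr_distl.
    by have := qP j; rewrite in_itv.
  exists (\row_j q j, n) => //; rewrite /F; case: asboolP => // -[].
  move=> y qy; apply: rU; apply: (@le_ball _ _ _ (s + s)).
    by rewrite [leRHS]splitr lerD// ltW.
  exact: ball_triangle (ball_sym qz) qy.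
apply: countable_bigcupT_measurable; first exact: countableP.
move=> qn; rewrite /F; case: ifP => // _; apply: measurable_preimage_ball.
by rewrite invr_gt0.
Qed.

Lemma measurable_comp_continuous (A : set 'rV[R]_d) (f : 'rV[R]_d -> R) :
  open A -> (forall x, A x -> {for x, continuous f}) ->
  measurable_fun (e @^-1` A) (f \o e).
Proof.
move=> oA cf; apply: (measurability _ (measurable_realfun.RGenOpens.measurableE R)).
move=> _ [_ [a [b ->] <-]].
rewrite comp_preimage -[X in measurable X]/(e @^-1` (A `&` f @^-1` _)).
apply: measurable_preimage_open.
rewrite openE => x [Ax fx]; apply: filterI; first exact: open_nbhs_nbhs.
apply: (cf x Ax); apply: open_nbhs_nbhs; split => //.
Qed.

End CoordinateMeasurability.

(** * Boxes and a uniform form of the integral in dimensions two and three *)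

Definition open_box {R : realType} {d : nat} (c : 'rV[R]_d) (s : R) : set 'rV[R]_d :=
  [set x | forall i, c 0 i < x 0 i < c 0 i + s].

Section Boxes.
Context {R : realType}.
Implicit Types s : R.
Local Notation mu := (@lebesgue_measure R).

Definition point2 (z : R * R) : 'rV[R]_2 := point_of_seq [:: z.1; z.2].
Definition point3 (z : R * R * R) : 'rV[R]_3 :=
  point_of_seq [:: z.1.1; z.1.2; z.2].

Lemma measurable_point2 i : measurable_fun setT (fun z => point2 z 0 i).
Proof.
have -> : (fun z => point2 z 0 i) = if i == 0 then fst else snd.
  apply/funext => z; rewrite mxE.
  by case: i => -[|[|]].
by case: ifP.
Qed.

Lemma measurable_point3 i : measurable_fun setT (fun z => point3 z 0 i).
Proof.
have -> : (fun z => point3 z 0 i) =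
    if i == 0 then fst \o fst else if i == 1 then snd \o fst else snd.
  apply/funext => z; rewrite mxE.
  by case: i => -[|[|[|]]].
by do ![case: ifP => _] => //; apply: measurableT_comp.
Qed.

Lemma point2_box (c : 'rV[R]_2) s :
  point2 @^-1` open_box c s =
  `]c 0 0, (c 0 0 + s)[ `*` `]c 0 1, (c 0 1 + s)[.
Proof.
apply/seteqP; split => -[x y] /=; rewrite !in_itv /=.
  by move=> H; have := H 0; have := H 1; rewrite !mxE /=.
move=> [Hx Hy] i; rewrite mxE.
have [->|->] : i = 0 \/ i = 1 by case: i => -[|[|//]] ?; [left|right]; exact: val_inj.
all: by [].
Qed.

Lemma point3_box (c : 'rV[R]_3) s :
  point3 @^-1` open_box c s =
  (`]c 0 0, (c 0 0 + s)[ `*` `]c 0 1, (c 0 1 + s)[)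
  `*` `]c 0 2, (c 0 2 + s)[.
Proof.
apply/seteqP; split => -[[x y] z] /=; rewrite !in_itv /=.
  by move=> H; have := H 0; have := H 1; have := H 2; rewrite !mxE /=.
move=> [[Hx Hy] Hz] i; rewrite mxE.
have [->|[->|->]] : i = 0 \/ i = 1 \/ i = 2.
  by case: i => -[|[|[|//]]] ?; [left|right; left|right; right]; exact: val_inj.
all: by [].
Qed.

Lemma lebesgue_measure_oo_fin (a b : R) : (mu `]a, b[ < +oo)%E.
Proof. by rewrite lebesgue_measure_itv /=; case: ifP => _; rewrite ?ltry -?EFinB ?ltry. Qed.

Lemma product_box2_fin (a b a' b' : R) :
  ((mu \x mu)%E (`]a, b[ `*` `]a', b'[) < +oo)%E.
Proof.
by rewrite product_measure1E// lte_mul_pinfty// ?ge0_fin_numE//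
  lebesgue_measure_oo_fin.
Qed.

Lemma product_box3_fin (a b a' b' a'' b'' : R) :
  (((mu \x mu) \x mu)%E ((`]a, b[ `*` `]a', b'[) `*` `]a'', b''[) < +oo)%E.
Proof.
have := product_measure1E (mu \x mu)%E mu
  (measurableX (measurable_itv `]a, b[) (measurable_itv `]a', b'[))
  (measurable_itv `]a'', b''[).
move=> /= ->; rewrite lte_mul_pinfty// ?ge0_fin_numE//.
  exact: product_box2_fin.
exact: lebesgue_measure_oo_fin.
Qed.

(** Hides the case distinction on [d] behind an abstract measure space with measurable coordinates.
    Linearity and monotonicity of the integral follow from these three properties alone; only
    Fubini's theorem has to look at the dimension again. *)
Lemma lebesgue_int_rep (d : nat) : d = 2%N \/ d = 3%N ->
  exists (disp : measure_display) (T : measurableType disp)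
    (nu : {measure set T -> \bar R}) (e : T -> 'rV[R]_d),
    [/\ forall i, measurable_fun setT (fun z => e z 0 i),
        forall A f, lebesgue_int A f = (\int[nu]_(z in e @^-1` A) f (e z))%R
      & forall c (s : R), (nu (e @^-1` open_box c s) < +oo)%E].
Proof.
case=> ->.
  exists _, _, (mu \x mu)%E, point2; split => //.
    exact: measurable_point2.
  by move=> c s; rewrite point2_box; exact: product_box2_fin.
exists _, _, ((mu \x mu) \x mu)%E, point3; split => //.
  exact: measurable_point3.
by move=> c s; rewrite point3_box; exact: product_box3_fin.
Qed.

End Boxes.

(** * Integration over the cube *)

Section BoundedContinuous.
Context {R : realType} {d : nat} (m : model R d).
Implicit Types f g : 'rV[R]_d -> R.

(** Implies integrability on the cube, which is open and of finite measure, and is stable under the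
    algebraic operations that build the integrands. *)
Definition bounded_continuous f : Prop :=
  (forall x, Omega m x -> {for x, continuous f}) /\
  exists B, forall x, Omega m x -> `|f x| <= B.

Local Notation bc := bounded_continuous.

Lemma open_Omega : open (Omega m).
Proof.
rewrite openE => x Ox.
suff : nbhs x (fun y : 'rV[R]_d => forall i, corner m 0 i < y 0 i < corner m 0 i + side m).
  exact: filterS.
apply: (@filter_forall _ _ (fun i (y : 'rV[R]_d) =>
  corner m 0 i < y 0 i < corner m 0 i + side m) (nbhs x)) => i.
have : \forall t \near x 0 i, t \in `]corner m 0 i, (corner m 0 i + side m)[.
  apply: open_nbhs_nbhs; split; first exact: interval_open.
  by rewrite /= in_itv; exact: Ox.
move=> /(@coord_continuous R 1 d 0 i x) /=; rewrite nbhs_simpl /=.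
by apply: (@filterS _ (nbhs x)) => y /=; rewrite in_itv.
Qed.

Lemma subset_Omega : Omega m `<=` closed_Omega m.
Proof. by move=> x Ox i; have /andP[] := Ox i; move=> /ltW -> /ltW ->. Qed.

Lemma bc_eq f g : (forall x, Omega m x -> f x = g x) -> bc f -> bc g.
Proof.
move=> fg [cf [B fB]]; split; last first.
  by exists B => x Ox; rewrite -fg//; exact: fB.
move=> x Ox; rewrite /prop_for /continuous_at -fg//.
apply: cvg_trans (cf x Ox).
apply: (@near_eq_cvg _ _ (nbhs x)).
have : nbhs x (Omega m); last first.
  by apply: (@filterS _ (nbhs x)) => y; exact: fg.
by apply: open_nbhs_nbhs; split => //; exact: open_Omega.
Qed.

Lemma bc_cst c : bc (fun=> c).
Proof. by split=> [x _|]; [exact: (@cst_continuous _ _ c x)|exists `|c|]. Qed.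

Lemma bcD f g : bc f -> bc g -> bc (fun x => f x + g x).
Proof.
move=> [cf [A fA]] [cg [B gB]]; split.
  by move=> x Ox; exact: (@continuousD _ _ _ f g x (cf x Ox) (cg x Ox)).
by exists (A + B) => x Ox; rewrite (le_trans (ler_normD _ _))// lerD ?fA ?gB.
Qed.

Lemma bcM f g : bc f -> bc g -> bc (fun x => f x * g x).
Proof.
move=> [cf [A fA]] [cg [B gB]]; split.
  by move=> x Ox; exact: (@continuousM _ _ f g x (cf x Ox) (cg x Ox)).
by exists (A * B) => x Ox; rewrite normrM ler_pM ?fA ?gB.
Qed.

Lemma bcN f : bc f -> bc (fun x => - f x).
Proof.
move=> bf; apply: (@bc_eq (fun x => -1 * f x)) => [x _|]; first by rewrite mulN1r.
exact: (bcM (bc_cst _) bf).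
Qed.

Lemma bcB f g : bc f -> bc g -> bc (fun x => f x - g x).
Proof. by move=> bf bg; exact: (bcD bf (bcN bg)). Qed.

Lemma bcX f n : bc f -> bc (fun x => f x ^+ n).
Proof.
move=> bf; elim: n => [|n IH]; first exact: bc_cst.
by apply: (@bc_eq (fun x => f x * f x ^+ n)) => [x _|]; [rewrite exprS|exact: bcM].
Qed.

Lemma bc_sum (I : Type) (r : seq I) (F : I -> 'rV[R]_d -> R) :
  (forall i, bc (F i)) -> bc (fun x => \sum_(i <- r) F i x).
Proof.
move=> bF; elim: r => [|i r IH].
  by apply: bc_eq (bc_cst 0) => x _; rewrite big_nil.
by apply: bc_eq (bcD (bF i) IH) => x _; rewrite big_cons.
Qed.

Local Notation I := (int_Omega m).
Context (hd : d = 2%N \/ d = 3%N).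

Lemma int_eq f g : (forall x, Omega m x -> f x = g x) -> I f = I g.
Proof.
move=> fg; have [disp [T [nu [e [_ lE _]]]]] := @lebesgue_int_rep R d hd.
by rewrite /int_Omega !lE; apply: eq_Rintegral => z; rewrite inE => /fg.
Qed.

Lemma bc_integrable f disp (T : measurableType disp)
    (nu : {measure set T -> \bar R}) (e : T -> 'rV[R]_d) :
  (forall i, measurable_fun setT (fun z => e z 0 i)) ->
  (nu (e @^-1` Omega m) < +oo)%E -> bc f ->
  nu.-integrable (e @^-1` Omega m) (EFin \o (f \o e)).
Proof.
move=> me nuO [cf [B fB]]; apply: measurable_bounded_integrable => //.
- exact: measurable_preimage_open open_Omega.
- exact: measurable_comp_continuous open_Omega cf.
- exists B; split; first exact: num_real.
  by move=> y By z /= /fB /le_trans; apply; exact: ltW.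
Qed.

Lemma intD f g : bc f -> bc g -> I (fun x => f x + g x) = I f + I g.
Proof.
move=> bf bg; have [disp [T [nu [e [me lE nuO]]]]] := @lebesgue_int_rep R d hd.
rewrite /int_Omega !lE RintegralD//.
- exact: measurable_preimage_open open_Omega.
- exact: bc_integrable me (nuO _ _) bf.
- exact: bc_integrable me (nuO _ _) bg.
Qed.

Lemma intZ c f : bc f -> I (fun x => c * f x) = c * I f.
Proof.
move=> bf; have [disp [T [nu [e [me lE nuO]]]]] := @lebesgue_int_rep R d hd.
rewrite /int_Omega !lE RintegralZl//.
- exact: measurable_preimage_open open_Omega.
- exact: bc_integrable me (nuO _ _) bf.
Qed.

Lemma intN f : bc f -> I (fun x => - f x) = - I f.
Proof.
by move=> bf; rewrite -mulN1r -intZ//; apply: int_eq => x _; rewrite mulN1r.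
Qed.

Lemma intB f g : bc f -> bc g -> I (fun x => f x - g x) = I f - I g.
Proof. by move=> bf bg; rewrite (intD bf (bcN bg)) intN. Qed.

Lemma int0 : I (fun=> 0) = 0.
Proof.
rewrite -[RHS](mul0r (I (fun=> 0))) -intZ; last exact: bc_cst.
by apply: int_eq => x _; rewrite mul0r.
Qed.

Lemma int_sum (J : Type) (r : seq J) (F : J -> 'rV[R]_d -> R) :
  (forall i, bc (F i)) ->
  I (fun x => \sum_(i <- r) F i x) = \sum_(i <- r) I (F i).
Proof.
move=> bF; elim: r => [|i r IH].
  by rewrite big_nil -[RHS]int0; apply: int_eq => x _; rewrite big_nil.
rewrite big_cons -IH -intD//; last exact: bc_sum.
by apply: int_eq => x _; rewrite big_cons.
Qed.

(** Holds for arbitrary [f] because an infinite integral has the real value 0; this lets L^2 norms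
    be squared for any field. *)
Lemma int_ge0 f : (forall x, Omega m x -> 0 <= f x) -> 0 <= I f.
Proof.
move=> f0; have [disp [T [nu [e [_ lE _]]]]] := @lebesgue_int_rep R d hd.
by rewrite /int_Omega lE; apply: Rintegral_ge0 => z /f0.
Qed.

Lemma le_int f g : bc f -> bc g ->
  (forall x, Omega m x -> f x <= g x) -> I f <= I g.
Proof.
move=> bf bg fg; rewrite -subr_ge0 -intB//.
by apply: int_ge0 => x /fg; rewrite subr_ge0.
Qed.

End BoundedContinuous.

(** Follows the shape of the integrand down to constants; every other leaf must be a hypothesis.
    Hence the lists of [bc] facts that open the proofs below. *)
Ltac solve_bc :=
  lazymatch goal with
  | |- bounded_continuous ?m (fun x => @?f x + @?g x) =>
      refine (@bcD _ _ m f g _ _); solve_bc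
  | |- bounded_continuous ?m (fun x => - @?f x) =>
      refine (@bcN _ _ m f _); solve_bc
  | |- bounded_continuous ?m (fun x => @?f x * @?g x) =>
      refine (@bcM _ _ m f g _ _); solve_bc
  | |- bounded_continuous ?m (fun x => @?f x ^+ ?n) =>
      refine (@bcX _ _ m f n _); solve_bc
  | |- bounded_continuous _ (fun=> ?c) => exact: bc_cst
  | |- _ => assumption
  end.

(** * The fundamental theorem of calculus on lines, and Fubini's theorem on boxes *)

Section Line.
Context {R : realType} {d : nat}.
Local Notation mu := (@lebesgue_measure R).

Lemma line_integral_pd_eq0 (g : 'rV[R]_d -> R) (k : 'I_d) (p : R -> 'rV[R]_d) (a b : R) :
  a < b -> (forall s t, p (s + t) = s *: delta_mx 0 k + p t) ->
  (forall t, a <= t <= b ->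
    [/\ derivable g (p t) (delta_mx 0 k), {for p t, continuous g}
      & {for p t, continuous (pd k g)}]) ->
  g (p a) = 0 -> g (p b) = 0 ->
  (\int[mu]_(t in `]a, b[) (pd k g (p t))%:E = 0)%E.
Proof.
move=> ab pE gp ga gb.
have cp : continuous p.
  have -> : p = (fun t => t *: delta_mx 0 k + p 0).
    by apply/funext => t; rewrite -pE addr0.
  move=> t; pose e : 'rV[R]_d := delta_mx 0 k.
  have ce : {for t, continuous (fun t : R => t *: e)} by exact: scalel_continuous.
  have c0 : {for t, continuous (fun _ : R => p 0)} by exact: cst_continuous.
  exact: (continuousD ce c0).
have cgp t : a <= t <= b -> {for t, continuous (g \o p)}.
  by move=> /gp[_ cg _]; apply: continuous_comp => //; exact: cp.
have cdgp t : a <= t <= b -> {for t, continuous (pd k g \o p)}.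
  by move=> /gp[_ _ cg]; apply: continuous_comp => //; exact: cp.
(* As [p] moves along the axis at unit speed, the difference quotients of [g \o p] are those of [g]
   in direction [k]. Derivability and derivative transfer without a chain rule, so axis-wise
   derivability of [g] suffices. *)
have quotE t : (fun h => h^-1 *: ((g \o p \o shift t) (h *: 1) - (g \o p) t)) =
    (fun h => h^-1 *: ((g \o shift (p t)) (h *: delta_mx 0 k) - g (p t))).
  by apply/funext => h /=; rewrite -pE [h *: 1]mulr1.
have cw : {within `[a, b], continuous (pd k g \o p)}.
  by apply: continuous_in_subspaceT => t; rewrite inE /= in_itv; exact: cdgp.
have := @continuous_FTC2 R (pd k g \o p) (g \o p) a b ab cw.
rewrite /= ga gb subee// => <- //.
- suff mpd : measurable_fun `]a, b[ (pd k g \o p).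
    rewrite -(@integral_itv_bndoo _ a b _ true false)//.
    exact: (measurable_EFinP _ _).2 mpd.
  apply: open_continuous_measurable_fun; first exact: interval_open.
  by move=> t; rewrite inE /= in_itv => /andP[/ltW ? /ltW ?]; apply: cdgp; apply/andP.
- split.
  + move=> t; rewrite in_itv => /andP[/ltW at_ /ltW tb] /=.
    have [dg _ _] := gp t (introT andP (conj at_ tb)).
    by move: dg; rewrite /derivable -quotE.
  + apply: cvg_at_right_filter; apply: cgp; by rewrite lexx ltW.
  + apply: cvg_at_left_filter; apply: cgp; by rewrite lexx ltW.
- by move=> t _; rewrite derive1E /pd /derive -quotE.
Qed.

End Line.

Section Slices.
Context {R : realType} {d1 d2 : measure_display}.
Context {T1 : measurableType d1} {T2 : measurableType d2}.
Context (m1 : {sigma_finite_measure set T1 -> \bar R}).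
Context (m2 : {sigma_finite_measure set T2 -> \bar R}).
Context (A1 : set T1) (A2 : set T2) (f : T1 * T2 -> \bar R).
Context (mA1 : measurable A1) (mA2 : measurable A2).
Context (fi : (m1 \x m2)%E.-integrable (A1 `*` A2) f).
Local Open Scope ereal_scope.

Let fi' : (m1 \x m2)%E.-integrable setT (f \_ (A1 `*` A2)).
Proof.
by apply/integrable_restrict; rewrite ?setTI//; exact: measurableX.
Qed.

(** Fubini's theorem for the extension of [f] by zero: the inner integral vanishes by assumption
    over [A2] and trivially elsewhere. *)
Lemma integral_eq0_slices1 :
  (forall y, A2 y -> \int[m1]_(x in A1) f (x, y) = 0) ->
  \int[m1 \x m2]_(z in A1 `*` A2) f z = 0.
Proof.
move=> f0; rewrite integral_mkcond -integral21_prod_meas1//.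
apply: integral0_eq => y _; rewrite /fubini_G.
have [A2y|A2y] := pselect (A2 y).
  rewrite -[RHS](f0 y A2y) [RHS]integral_mkcond.
  apply: eq_integral => x _; rewrite !patchE.
  congr (if _ then _ else _); apply/idP/idP; rewrite !inE => //=.
  by case.
apply: integral0_eq => x _; rewrite patchE ifF//.
by apply/negbTE/negP; rewrite inE => -[].
Qed.

Lemma integral_eq0_slices2 :
  (forall x, A1 x -> \int[m2]_(y in A2) f (x, y) = 0) ->
  \int[m1 \x m2]_(z in A1 `*` A2) f z = 0.
Proof.
move=> f0; rewrite integral_mkcond -integral12_prod_meas1//.
apply: integral0_eq => x _; rewrite /fubini_F.
have [A1x|A1x] := pselect (A1 x).
  rewrite -[RHS](f0 x A1x) [RHS]integral_mkcond.
  apply: eq_integral => y _; rewrite !patchE.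
  congr (if _ then _ else _); apply/idP/idP; rewrite !inE => //=.
  by case.
apply: integral0_eq => y _; rewrite patchE ifF//.
by apply/negbTE/negP; rewrite inE => -[].
Qed.

End Slices.

Section ProductLebesgue.
Context {R : realType}.
Local Notation mu := (@lebesgue_measure R).

(* The sigma-finite instance that the library declares on products is shadowed
   by the one for subprobabilities, whence this copy of [mu \x mu]. *)
Definition lebesgue2 := (mu \x mu)%E.

HB.instance Definition _ := Measure.on lebesgue2.

Let sigma_finite_lebesgue2 : sigma_finite setT lebesgue2.
Proof.
have /sigma_finiteP[F [TF ndF Foo]] := sigma_finiteT mu.
exists (fun n => F n `*` F n).
  rewrite -setXTT TF predeqE => -[x y]; split.
    move=> [/= [n _ Fnx] [k _ Fky]]; exists (maxn n k) => //; split.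
    - by move: x Fnx; exact/subsetPset/ndF/leq_maxl.
    - by move: y Fky; exact/subsetPset/ndF/leq_maxr.
  by move=> [n _ []/= ? ?]; split; exists n.
move=> k; have [? ?] := Foo k; split; first exact: measurableX.
rewrite /lebesgue2 product_measure1E// lte_mul_pinfty// ge0_fin_numE//.
Qed.

HB.instance Definition _ :=
  Measure_isSigmaFinite.Build _ _ _ lebesgue2 sigma_finite_lebesgue2.

End ProductLebesgue.

Section BoundaryIntegral.
Context {R : realType}.
Local Notation mu := (@lebesgue_measure R).

(** What the fundamental theorem on axis-parallel lines uses. The open neighbourhood gives meaning
    to derivatives at boundary points of the cube. *)
Definition partially_C1 (d : nat) (m : model R d) (f : 'rV[R]_d -> R) : Prop :=
  exists U : set 'rV[R]_d, [/\ open U, closed_Omega m `<=` U &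
    forall x, U x -> {for x, continuous f} /\ forall k,
      derivable f x (delta_mx 0 k) /\ {for x, continuous (pd k f)}].

(** Continuity passes to the open subset, and the bound comes from compactness of the closed
    cube. *)
Lemma bc_within (d : nat) (m : model R d) (f : 'rV[R]_d -> R) :
  {within closed_Omega m, continuous f} -> bounded_continuous m f.
Proof.
move=> cf; split.
  move=> x Ox; have := continuous_subspaceW (@subset_Omega R d m) cf.
  by rewrite continuous_open_subspace; [apply; rewrite inE|exact: open_Omega].
have cO : compact (closed_Omega m).
  rewrite (_ : closed_Omega m = [set v : 'rV[R]_d | forall i,
      v 0 i \in `[corner m 0 i, (corner m 0 i + side m)]]).
    apply: (@rV_compact R d (fun i => [set` `[corner m 0 i, (corner m 0 i + side m)]])).
    by move=> i; exact: segment_compact.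
  by apply/seteqP; split => x /= H i; have := H i; rewrite /= in_itv.
have [B [_ HB]] := compact_bounded (continuous_compact cf cO).
(* [compact_bounded] gives every real above [B] as a bound, but not [B] itself. *)
exists (B + 1) => x Ox; apply: (HB (B + 1)); first by rewrite ltrDl.
by exists x => //; exact: subset_Omega.
Qed.

Lemma bc_continuous (d : nat) (m : model R d) (f : 'rV[R]_d -> R) :
  (forall x, closed_Omega m x -> {for x, continuous f}) ->
  bounded_continuous m f.
Proof.
move=> cf; apply: bc_within; apply: continuous_in_subspaceT => x.
by rewrite inE; exact: cf.
Qed.

Lemma partially_C1_bc (d : nat) (m : model R d) (f : 'rV[R]_d -> R) :
  partially_C1 m f -> bounded_continuous m f.
Proof.
by move=> [U [_ OU fU]]; apply: bc_continuous => x /OU /fU[].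
Qed.

Lemma partially_C1_pd_bc (d : nat) (m : model R d) (f : 'rV[R]_d -> R) k :
  partially_C1 m f -> bounded_continuous m (pd k f).
Proof.
by move=> [U [_ OU fU]]; apply: bc_continuous => x /OU /fU[_ /(_ k)[]].
Qed.

Lemma ord2P (k : 'I_2) : k = 0 \/ k = 1.
Proof. by case: k => -[|[|//]] ?; [left|right]; exact: val_inj. Qed.

Lemma ord3P (k : 'I_3) : [\/ k = 0, k = 1 | k = 2].
Proof.
by case: k => -[|[|[|//]]] ?; [constructor 1|constructor 2|constructor 3];
  exact: val_inj.
Qed.

(** Restricted to the relative interiors of the two faces orthogonal to axis [k], which is exactly
    where [outward_normal] provides Neumann data. The lines over which Fubini's theorem integrates
    end there. *)
Definition vanishes_on_faces (d : nat) (m : model R d) (k : 'I_d)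
    (g : 'rV[R]_d -> R) : Prop :=
  forall x : 'rV[R]_d,
    (forall i, i != k -> corner m 0 i < x 0 i < corner m 0 i + side m) ->
    x 0 k = corner m 0 k \/ x 0 k = corner m 0 k + side m -> g x = 0.

Local Notation itv m i := [set` `]corner m 0%R i, (corner m 0%R i + side m)%R[%R].

Lemma line_pd_eq0 (d : nat) (m : model R d) (k : 'I_d) (g : 'rV[R]_d -> R)
    (p : R -> 'rV[R]_d) :
  0 < side m -> partially_C1 m g -> vanishes_on_faces m k g ->
  (forall s t, p (s + t) = s *: delta_mx 0 k + p t) ->
  (forall t, p t 0 k = t) ->
  (forall t i, i != k -> corner m 0 i < p t 0 i < corner m 0 i + side m) ->
  (\int[mu]_(t in itv m k)
     (pd k g (p t))%:E = 0)%E.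
Proof.
move=> s0 [U [_ OU gU]] g0 pE pk pi; apply: line_integral_pd_eq0 => //.
- by rewrite ltrDl.
- move=> t tab; have /OU/gU[cg /(_ k)[]//] : closed_Omega m (p t).
  move=> i; have [->|ik] := eqVneq i k; first by rewrite pk.
  by have /andP[/ltW -> /ltW ->] := pi t i ik.
- by apply: g0; [exact: pi|left].
- by apply: g0; [exact: pi|right].
Qed.


Lemma point2_shift0 (s t y : R) :
  point2 (s + t, y) = s *: delta_mx 0 0 + point2 (t, y).
Proof. by apply/rowP => i; have [->|->] := ord2P i; rewrite !mxE /= ?mulr1 ?mulr0 ?add0r. Qed.

Lemma point2_shift1 (s t y : R) :
  point2 (y, s + t) = s *: delta_mx 0 1 + point2 (y, t).
Proof. by apply/rowP => i; have [->|->] := ord2P i; rewrite !mxE /= ?mulr1 ?mulr0 ?add0r. Qed.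

Lemma int_pd_eq0_2 (m : model R 2) (k : 'I_2) (g : 'rV[R]_2 -> R) :
  0 < side m -> partially_C1 m g -> vanishes_on_faces m k g ->
  int_Omega m (pd k g) = 0.
Proof.
move=> s0 gC g0.
have -> : int_Omega m (pd k g) = fine (\int[(mu \x mu)%E]_(z in point2 @^-1`
    open_box (corner m) (side m)) (pd k g (point2 z))%:E)%E by [].
rewrite point2_box -[RHS]/(fine 0%E); congr fine.
have gi : (mu \x mu)%E.-integrable (itv m 0 `*` itv m 1) (EFin \o (pd k g \o point2)).
  rewrite -point2_box.
  apply: (@bc_integrable R 2 m (pd k g) _ _ (mu \x mu)%E point2 measurable_point2).
    by rewrite [_ @^-1` _]point2_box; exact: product_box2_fin.
  exact: partially_C1_pd_bc.
move: gi g0; have [->|->] := ord2P k => gi g0.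
  apply: integral_eq0_slices1 => // y yI.
  apply: (@line_pd_eq0 2 m 0 g (fun t => point2 (t, y))) => //.
  - by move=> s t; exact: point2_shift0.
  - by move=> t; rewrite mxE.
  - by move=> t i; have [->//|->] := ord2P i; rewrite mxE /= in_itv /= in yI *.
apply: integral_eq0_slices2 => // y yI.
apply: (@line_pd_eq0 2 m 1 g (fun t => point2 (y, t))) => //.
- by move=> s t; exact: point2_shift1.
- by move=> t; rewrite mxE.
- by move=> t i; have [->|->//] := ord2P i; rewrite mxE /= in_itv /= in yI *.
Qed.

Lemma point3_shift (k : 'I_3) (s t x y : R) :
  let p t := if k == 0 then point3 (t, x, y) else
             if k == 1 then point3 (x, t, y) else point3 (x, y, t) in
  p (s + t) = s *: delta_mx 0 k + p t.
Proof.
by have [->|->|->] := ord3P k; apply/rowP => i; have [->|->|->] := ord3P i;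
  rewrite !mxE /= ?mulr1 ?mulr0 ?add0r.
Qed.

(** The measure is a nested product, with the last coordinate outermost. For [k = 2] one use of
    Fubini's theorem reaches the lines; for the other axes the horizontal slices are split once
    more. *)
Lemma int_pd_eq0_3 (m : model R 3) (k : 'I_3) (g : 'rV[R]_3 -> R) :
  0 < side m -> partially_C1 m g -> vanishes_on_faces m k g ->
  int_Omega m (pd k g) = 0.
Proof.
move=> s0 gC g0.
have -> : int_Omega m (pd k g) = fine (\int[((mu \x mu) \x mu)%E]_(z in point3 @^-1`
    open_box (corner m) (side m)) (pd k g (point3 z))%:E)%E by [].
rewrite point3_box -[RHS]/(fine 0%E); congr fine.
have gi : ((mu \x mu) \x mu)%E.-integrable ((itv m 0 `*` itv m 1) `*` itv m 2)
    (EFin \o (pd k g \o point3)).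
  rewrite -point3_box.
  apply: (@bc_integrable R 3 m (pd k g) _ _ ((mu \x mu) \x mu)%E point3
    measurable_point3).
    by rewrite [_ @^-1` _]point3_box; exact: product_box3_fin.
  exact: partially_C1_pd_bc.
(* Integrability on every horizontal slice comes from bounded continuity; Fubini's theorem would
   give it for almost every [z] only. *)
have gi2 z : itv m 2 z -> (mu \x mu)%E.-integrable (itv m 0 `*` itv m 1)
    (EFin \o (pd k g \o (fun w => point3 (w, z)))).
  move=> zI.
  have zE : (fun w => point3 (w, z)) @^-1` Omega m = itv m 0 `*` itv m 1.
    rewrite -[LHS]/[set w | (point3 @^-1` open_box (corner m) (side m)) (w, z)].
    by rewrite point3_box; apply/seteqP; split => w /=; [case|].
  rewrite -zE; apply: (@bc_integrable R 3 m (pd k g) _ _ (mu \x mu)%E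
    (fun w => point3 (w, z))).
  - by move=> i; apply: (measurableT_comp (measurable_point3 i)).
  - by rewrite zE; exact: product_box2_fin.
  - exact: partially_C1_pd_bc.
move: gi gi2 g0; have [->|->|->] := ord3P k => gi gi2 g0.
- apply: (@integral_eq0_slices1 R _ _ _ _ lebesgue2 mu _ _ _
    (measurableX (measurable_itv _) (measurable_itv _)) (measurable_itv _) gi) => z zI.
  apply: (@integral_eq0_slices1 R _ _ _ _ mu mu _ _ _
    (measurable_itv _) (measurable_itv _) (gi2 z zI)).
  move=> y yI.
  apply: (@line_pd_eq0 3 m 0 g (fun t => point3 (t, y, z)) s0 gC g0).
  + by move=> s t; exact: (point3_shift 0).
  + by move=> t; rewrite mxE.
  + by move=> t i; have [->//|->|->] := ord3P i; rewrite mxE /= ?in_itv /= in yI zI *.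
- apply: (@integral_eq0_slices1 R _ _ _ _ lebesgue2 mu _ _ _
    (measurableX (measurable_itv _) (measurable_itv _)) (measurable_itv _) gi) => z zI.
  apply: (@integral_eq0_slices2 R _ _ _ _ mu mu _ _ _
    (measurable_itv _) (measurable_itv _) (gi2 z zI)).
  move=> y yI.
  apply: (@line_pd_eq0 3 m 1 g (fun t => point3 (y, t, z)) s0 gC g0).
  + by move=> s t; exact: (point3_shift 1).
  + by move=> t; rewrite mxE.
  + by move=> t i; have [->|->//|->] := ord3P i; rewrite mxE /= ?in_itv /= in yI zI *.
- apply: (@integral_eq0_slices2 R _ _ _ _ lebesgue2 mu _ _ _
    (measurableX (measurable_itv _) (measurable_itv _)) (measurable_itv _) gi)
    => -[x y] [xI yI].
  apply: (@line_pd_eq0 3 m 2 g (fun t => point3 (x, y, t)) s0 gC g0).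
  + by move=> s t; exact: (point3_shift 2).
  + by move=> t; rewrite mxE.
  + by move=> t i; have [->|->|->//] := ord3P i; rewrite mxE /= ?in_itv /= in xI yI *.
Qed.

Lemma int_pd_eq0 (d : nat) (m : model R d) (k : 'I_d) (g : 'rV[R]_d -> R) :
  d = 2%N \/ d = 3%N -> 0 < side m -> partially_C1 m g ->
  vanishes_on_faces m k g -> int_Omega m (pd k g) = 0.
Proof.
by move=> hd; case: hd m k g => -> m k g;
  [exact: int_pd_eq0_2|exact: int_pd_eq0_3].
Qed.

End BoundaryIntegral.

(** * Partial derivatives *)

Section PartialDerivatives.
Context {R : realType} {d : nat} (m : model R d).
Implicit Types f g : 'rV[R]_d -> R.

Local Notation pC1 := (partially_C1 m).

Lemma near_eq_continuous f g (x : 'rV[R]_d) :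
  {near x, f =1 g} -> {for x, continuous f} -> {for x, continuous g}.
Proof.
move=> fg cf; have fgx : f x = g x by exact: (nbhs_singleton fg).
rewrite /prop_for /continuous_at -fgx.
apply: cvg_trans cf; exact: (@near_eq_cvg _ _ (nbhs x)).
Qed.

(** Agreement is required on a neighbourhood of the closed cube, because derivatives at its boundary
    points look outside it. *)
Lemma pC1_eq f g (V : set 'rV[R]_d) :
  open V -> closed_Omega m `<=` V -> (forall x, V x -> f x = g x) ->
  pC1 f -> pC1 g.
Proof.
move=> oV OV fg [U [oU OU fU]]; exists (U `&` V); split.
- exact: openI.
- by move=> x Ox; split; [exact: OU|exact: OV].
move=> x [Ux Vx].
have near_fg y : V y -> {near y, f =1 g}.
  move=> Vy; have : nbhs y V by exact: open_nbhs_nbhs.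
  by apply: (@filterS _ (nbhs y)) => z; exact: fg.
have [cf df] := fU x Ux; split.
  by apply: near_eq_continuous cf; exact: near_fg.
move=> k; have [dk ck] := df k; split.
  by apply: near_eq_derivable dk; exact: near_fg.
apply: near_eq_continuous ck.
have : nbhs x V by exact: open_nbhs_nbhs.
apply: (@filterS _ (nbhs x)) => z Vz; apply: near_eq_derive; exact: near_fg.
Qed.

Lemma pC1_cst c : pC1 (fun=> c).
Proof.
exists setT; split => //; first exact: openT.
move=> x _; split; first exact: (@cst_continuous _ _ c x).
move=> k; split; first exact: derivable_cst.
have -> : pd k (fun=> c) = (fun=> 0) :> ('rV[R]_d -> R).
  by apply/funext => y; exact: derive_cst.
exact: (@cst_continuous _ _ (0 : R) x).
Qed.

Lemma pC1D f g : pC1 f -> pC1 g -> pC1 (fun x => f x + g x).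
Proof.
move=> [U [oU OU fU]] [V [oV OV gV]]; exists (U `&` V); split.
- exact: openI.
- by move=> x Ox; split; [exact: OU|exact: OV].
move=> x [Ux Vx]; have [cf df] := fU x Ux; have [cg dg] := gV x Vx; split.
  exact: (@continuousD _ _ _ f g x).
move=> k; split; first by apply: (@derivableD _ _ _ f g); [case: (df k)|case: (dg k)].
have c := @continuousD _ _ _ _ _ _ (df k).2 (dg k).2.
apply: near_eq_continuous c.
have : nbhs x (U `&` V) by apply: open_nbhs_nbhs; split => //; exact: openI.
apply: (@filterS _ (nbhs x)) => z [Uz Vz]; rewrite /pd [RHS](@deriveD _ _ _ f g)//.
  by have [_ /(_ k)[]] := fU z Uz.
by have [_ /(_ k)[]] := gV z Vz.
Qed.

Lemma pdD f g k x : pC1 f -> pC1 g -> closed_Omega m x ->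
  pd k (fun y => f y + g y) x = pd k f x + pd k g x.
Proof.
move=> [U [_ OU fU]] [V [_ OV gV]] Ox; rewrite /pd [LHS](@deriveD _ _ _ f g)//.
  by have [_ /(_ k)[]] := fU x (OU x Ox).
by have [_ /(_ k)[]] := gV x (OV x Ox).
Qed.

Lemma pC1M f g : pC1 f -> pC1 g -> pC1 (fun x => f x * g x).
Proof.
move=> [U [oU OU fU]] [V [oV OV gV]]; exists (U `&` V); split.
- exact: openI.
- by move=> x Ox; split; [exact: OU|exact: OV].
move=> x [Ux Vx]; have [cf df] := fU x Ux; have [cg dg] := gV x Vx; split.
  exact: (@continuousM _ _ f g x).
move=> k; split; first by apply: (@derivableM _ _ f g); [case: (df k)|case: (dg k)].
have c := @continuousD _ _ _ _ _ _ (continuousM cf (dg k).2) (continuousM cg (df k).2).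
apply: near_eq_continuous c.
have : nbhs x (U `&` V) by apply: open_nbhs_nbhs; split => //; exact: openI.
apply: (@filterS _ (nbhs x)) => z [Uz Vz]; rewrite /pd [RHS](@deriveM _ _ f g)//.
  by have [_ /(_ k)[]] := fU z Uz.
by have [_ /(_ k)[]] := gV z Vz.
Qed.

Lemma pdM f g k x : pC1 f -> pC1 g -> closed_Omega m x ->
  pd k (fun y => f y * g y) x = f x * pd k g x + g x * pd k f x.
Proof.
move=> [U [_ OU fU]] [V [_ OV gV]] Ox; rewrite /pd [LHS](@deriveM _ _ f g)//.
  by have [_ /(_ k)[]] := fU x (OU x Ox).
by have [_ /(_ k)[]] := gV x (OV x Ox).
Qed.

Lemma pC1Z c f : pC1 f -> pC1 (fun x => c * f x).
Proof. by apply: pC1M; exact: pC1_cst. Qed.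

Lemma pdZ c f k x : pC1 f -> closed_Omega m x ->
  pd k (fun y => c * f y) x = c * pd k f x.
Proof.
move=> fC Ox; rewrite (pdM k (pC1_cst c) fC Ox).
by rewrite [pd k (fun=> c) x]derive_cst mulr0 addr0.
Qed.

Lemma pC1N f : pC1 f -> pC1 (fun x => - f x).
Proof.
move=> fC; rewrite (_ : (fun x => _) = (fun x => -1 * f x)).
  exact: (pC1Z _ fC).
by apply/funext => x; rewrite mulN1r.
Qed.

Lemma pC1B f g : pC1 f -> pC1 g -> pC1 (fun x => f x - g x).
Proof. by move=> fC gC; exact: (pC1D fC (pC1N gC)). Qed.

Lemma pdB f g k x : pC1 f -> pC1 g -> closed_Omega m x ->
  pd k (fun y => f y - g y) x = pd k f x - pd k g x.
Proof.
move=> fC gC Ox; rewrite (pdD k fC (pC1N gC) Ox).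
congr (_ + _); rewrite -[RHS]mulN1r -(pdZ _ k gC Ox).
by congr (pd k _ x); apply/funext => y; rewrite mulN1r.
Qed.

Lemma pC1_sum (J : Type) (r : seq J) (F : J -> 'rV[R]_d -> R) :
  (forall j, pC1 (F j)) -> pC1 (fun x => \sum_(j <- r) F j x).
Proof.
move=> FC; elim: r => [|j r IH].
  rewrite (_ : (fun _ => _) = (fun=> 0)); first exact: pC1_cst.
  by apply/funext => x; rewrite big_nil.
rewrite (_ : (fun _ => _) = (fun x => F j x + \sum_(i <- r) F i x)).
  exact: (pC1D (FC j) IH).
by apply/funext => x; rewrite big_cons.
Qed.

Lemma pC1_C1 f : C1 m (f : 'rV[R]_d -> R^o) -> pC1 f.
Proof.
move=> [U [oU OU fU]]; exists U; split => // x /fU[df cf]; split.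
  exact: (differentiable_continuous df).
by move=> k; split; [exact: (diff_derivable df)|exact: cf].
Qed.

Section Matrices.
Context {p q : nat}.
Implicit Types Q : 'rV[R]_d -> 'M[R]_(p, q).

Lemma pd_entry_diff Q k x i j : differentiable Q x ->
  pd k Q x i j = pd k (fun y => Q y i j) x.
Proof. by move=> dQ; rewrite /pd derive_mx ?mxE//; exact: (diff_derivable dQ). Qed.

Lemma pC1_entry Q i j : C1 m Q -> pC1 (fun x => Q x i j).
Proof.
move=> [U [oU OU QU]]; exists U; split => // x Ux; have [dQ cQ] := QU x Ux.
have dQij : differentiable (fun y => Q y i j) x.
  apply: (@differentiable_comp _ _ _ _ Q (fun N : 'M[R]_(p, q) => N i j)) => //.
  exact: differentiable_coord.
split; first exact: (differentiable_continuous dQij).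
move=> k; split; first exact: (diff_derivable dQij).
have cQij : {for x, continuous (fun y => pd k Q y i j)}.
  apply: (@continuous_comp _ _ _ (pd k Q) (fun N : 'M[R]_(p, q) => N i j)).
    exact: cQ.
  exact: coord_continuous.
apply: near_eq_continuous cQij.
have : nbhs x U by exact: open_nbhs_nbhs.
apply: (@filterS _ (nbhs x)) => y /QU[dQy _]; exact: pd_entry_diff.
Qed.

Lemma pC1_pd_entry Q k i j : C2 m Q -> pC1 (pd k (fun x => Q x i j)).
Proof.
move=> [[U [oU OU QU]] dQC]; apply: (@pC1_eq (fun x => pd k Q x i j) _ U) => //.
  by move=> x /QU[dQ _]; exact: pd_entry_diff.
exact/pC1_entry/dQC.
Qed.

End Matrices.

End PartialDerivatives.

(** * The Frobenius inner product *)

Section MatrixInnerProduct.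
Context {R : realType} {p q : nat}.
Implicit Types P Q S : 'M[R]_(p, q).

Lemma ddotE P Q : ddot P Q = \sum_i \sum_j P i j * Q i j.
Proof.
rewrite /ddot /mxtrace exchange_big; apply: eq_bigr => j _.
by rewrite mxE; apply: eq_bigr => i _; rewrite mxE.
Qed.

Lemma ddotC P Q : ddot P Q = ddot Q P.
Proof. by rewrite !ddotE; do 2!apply: eq_bigr => ? _; rewrite mulrC. Qed.

Lemma ddotDl P Q S : ddot (P + Q) S = ddot P S + ddot Q S.
Proof. by rewrite /ddot raddfD /= mulmxDl mxtraceD. Qed.

Lemma ddotDr P Q S : ddot S (P + Q) = ddot S P + ddot S Q.
Proof. by rewrite !(ddotC S) ddotDl. Qed.

Lemma ddotZl c P Q : ddot (c *: P) Q = c * ddot P Q.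
Proof. by rewrite /ddot linearZ /= -scalemxAl mxtraceZ. Qed.

Lemma ddotZr c P Q : ddot P (c *: Q) = c * ddot P Q.
Proof. by rewrite !(ddotC P) ddotZl. Qed.

Lemma ddotNl P Q : ddot (- P) Q = - ddot P Q.
Proof. by rewrite -scaleN1r ddotZl mulN1r. Qed.

Lemma ddotNr P Q : ddot P (- Q) = - ddot P Q.
Proof. by rewrite !(ddotC P) ddotNl. Qed.

Definition ddotEs := (ddotDl, ddotDr, ddotNl, ddotNr, ddotZl, ddotZr).

Lemma sqnorm_ge0 P : 0 <= sqnorm P.
Proof.
rewrite /sqnorm ddotE; do 2!apply: sumr_ge0 => ? _.
by rewrite -expr2 sqr_ge0.
Qed.

End MatrixInnerProduct.

(** Replaces [vgrad] by [symgrad] after integration by parts, for the viscous stress and for the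
    active stress alike. *)
Lemma ddot_symmetric {R : realType} {d : nat} (S : 'M[R]_d) (G : 'M[R]_d) :
  S^T = S -> ddot S (2^-1 *: (G + G^T)) = ddot S G.
Proof.
move=> sS; rewrite !ddotEs.
have -> : ddot S G^T = ddot S G.
  by rewrite /ddot sS -[LHS]mxtrace_tr trmx_mul trmxK sS mxtrace_mulC.
by field.
Qed.

(** * Integration by parts for scalars, vectors and tensors *)

Section IntegrationByParts.
Context {R : realType} {d : nat} (m : model R d).
Context (hd : d = 2%N \/ d = 3%N) (s0 : 0 < side m).
Implicit Types f g : 'rV[R]_d -> R.
Local Notation pC1 := (partially_C1 m).
Local Notation bc := (bounded_continuous m).
Local Notation I := (int_Omega m).

(** The boundary condition concerns the product, so that no-slip, Dirichlet and Neumann data are all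
    covered. *)
Lemma int_by_parts f g k : pC1 f -> pC1 g ->
  vanishes_on_faces m k (fun x => f x * g x) ->
  I (fun x => pd k f x * g x) = - I (fun x => f x * pd k g x).
Proof.
move=> fC gC fg0.
have bf := partially_C1_bc fC; have bg := partially_C1_bc gC.
have bdf := partially_C1_pd_bc k fC; have bdg := partially_C1_pd_bc k gC.
apply/eqP; rewrite -addr_eq0 -(intD hd); [|exact: bcM..].
rewrite -(int_pd_eq0 hd s0 (pC1M fC gC) fg0); apply/eqP.
apply: int_eq => // x Ox; rewrite (pdM k fC gC); last exact: subset_Omega.
by rewrite addrC [g x * _]mulrC.
Qed.

(** The direction depends on the index: double and triple contractions become one sum over a product
    type. *)
Lemma int_by_parts_sum (J : finType) (f g : J -> 'rV[R]_d -> R) (k : J -> 'I_d) :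
  (forall j, pC1 (f j)) -> (forall j, pC1 (g j)) ->
  (forall j, vanishes_on_faces m (k j) (fun x => f j x * g j x)) ->
  I (fun x => \sum_j pd (k j) (f j) x * g j x) =
  - I (fun x => \sum_j f j x * pd (k j) (g j) x).
Proof.
move=> fC gC fg0.
rewrite !int_sum//.
- by rewrite -sumrN; apply: eq_bigr => j _; exact: int_by_parts.
- by move=> j; apply: bcM; [exact/partially_C1_bc/fC|exact/partially_C1_pd_bc/gC].
- by move=> j; apply: bcM; [exact/partially_C1_pd_bc/fC|exact/partially_C1_bc/gC].
Qed.

Lemma face_bd_Omega k (x : 'rV[R]_d) :
  (forall i, i != k -> corner m 0 i < x 0 i < corner m 0 i + side m) ->
  x 0 k = corner m 0 k \/ x 0 k = corner m 0 k + side m -> bd_Omega m x.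
Proof.
move=> xi xk; split.
  move=> i; have [->|/xi/andP[/ltW -> /ltW ->]//] := eqVneq i k.
  by case: xk => ->; rewrite ?lexx ?lerDl ltW.
by move=> /(_ k); case: xk => ->; rewrite ltxx ?andbF.
Qed.

Lemma int_tdiv_ddot (T : 'rV[R]_d -> 'M[R]_d) (v : 'rV[R]_d -> 'rV[R]_d) :
  (forall i j, pC1 (fun x => T x i j)) -> (forall k, pC1 (fun x => v x 0 k)) ->
  (forall x, bd_Omega m x -> v x = 0) ->
  I (fun x => ddot (tdiv T x) (v x)) = - I (fun x => ddot (T x) (vgrad v x)).
Proof.
move=> TC vC v0.
rewrite (@int_eq _ _ _ hd _ (fun x => \sum_(ij : 'I_d * 'I_d)
  pd ij.2 (fun y => T y ij.1 ij.2) x * v x 0 ij.1)); last first.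
  move=> x _; rewrite ddotE big_ord1.
  rewrite -(pair_bigA _ (fun i j => pd j (fun y => T y i j) x * v x 0 i)).
  by apply: eq_bigr => i _; rewrite mxE mulr_suml.
rewrite int_by_parts_sum //=; last first.
  by move=> ij x xi /(face_bd_Omega xi)/v0 ->; rewrite mxE mulr0.
congr (- _); apply: int_eq => // x _; rewrite ddotE pair_bigA.
by apply: eq_bigr => ij _; rewrite mxE.
Qed.

Lemma int_grad_ddot (p : 'rV[R]_d -> R) (v : 'rV[R]_d -> 'rV[R]_d) :
  pC1 p -> (forall k, pC1 (fun x => v x 0 k)) ->
  (forall x, bd_Omega m x -> v x = 0) ->
  (forall x, Omega m x -> vdiv v x = 0) ->
  I (fun x => ddot (grad p x) (v x)) = 0.
Proof.
move=> pC vC v0 divv.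
rewrite (@int_eq _ _ _ hd _ (fun x => \sum_i pd i p x * v x 0 i)); last first.
  by move=> x _; rewrite ddotE big_ord1; apply: eq_bigr => i _; rewrite mxE.
rewrite (@int_by_parts_sum _ (fun=> p) (fun i x => v x 0 i) id); last 3 first.
- by move=> _; exact: pC.
- exact: vC.
- by move=> i x xi /(face_bd_Omega xi)/v0 ->; rewrite mxE mulr0.
rewrite (@int_eq _ _ _ hd _ (fun=> 0)) ?int0 ?oppr0// => x Ox.
by rewrite -mulr_sumr -[X in _ * X]/(vdiv v x) divv// mulr0.
Qed.

Lemma pd_entry_pC1 (p q : nat) (Q : 'rV[R]_d -> 'M[R]_(p, q)) k x i j :
  (forall i j, pC1 (fun x => Q x i j)) -> closed_Omega m x ->
  pd k Q x i j = pd k (fun y => Q y i j) x.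
Proof.
move=> QC Ox; rewrite /pd derive_mx ?mxE//; apply/derivable_mxP => i' j'.
by have [U [_ OU /(_ x (OU x Ox))[_ /(_ k)[]]]] := QC i' j'.
Qed.

Lemma div_Kgrad_entry (K : 'rV[R]_d -> R) (Q : 'rV[R]_d -> 'M[R]_d) x i j :
  pC1 K -> C2 m Q -> closed_Omega m x ->
  div_Kgrad K Q x i j =
  \sum_k pd k (fun y => K y * pd k (fun z => Q z i j) y) x.
Proof.
move=> KC [QC dQC] Ox; rewrite /div_Kgrad summxE; apply: eq_bigr => k _.
have KQE i' j' : (fun y => (K y *: pd k Q y) i' j') = (fun y => K y * pd k Q y i' j').
  by apply/funext => y; rewrite mxE.
have KQC i' j' : pC1 (fun y => (K y *: pd k Q y) i' j').
  by rewrite KQE; apply: (pC1M KC); exact: pC1_entry (dQC k).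
rewrite (pd_entry_pC1 k i j KQC Ox) KQE.
have [U [oU OU QU]] := QC.
(* Entries commute with [pd] only where [Q] is differentiable; agreement near [x] is enough for the
   outer derivative. *)
apply: near_eq_derive; have : nbhs x U by apply: open_nbhs_nbhs; split; last exact: OU.
apply: (@filterS _ (nbhs x)) => y /QU[dQy _].
by rewrite -[in RHS](pd_entry_diff k i j dQy).
Qed.

Lemma int_div_Kgrad_ddot (K : 'rV[R]_d -> R) (Q P : 'rV[R]_d -> 'M[R]_d) :
  pC1 K -> C2 m Q -> (forall i j, pC1 (fun x => P x i j)) ->
  (forall i j k, vanishes_on_faces m k
     (fun x => K x * pd k (fun y => Q y i j) x * P x i j)) ->
  I (fun x => ddot (div_Kgrad K Q x) (P x)) =
  - I (fun x => K x * \sum_k ddot (pd k Q x) (pd k P x)).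
Proof.
move=> KC QC PC PQ0.
rewrite (@int_eq _ _ _ hd _ (fun x => \sum_(ijk : ('I_d * 'I_d) * 'I_d)
  pd ijk.2 (fun y => K y * pd ijk.2 (fun z => Q z ijk.1.1 ijk.1.2) y) x *
  P x ijk.1.1 ijk.1.2)); last first.
  move=> x Ox; rewrite ddotE pair_bigA.
  rewrite -(pair_bigA _ (fun (ij : 'I_d * 'I_d) k =>
    pd k (fun y => K y * pd k (fun z => Q z ij.1 ij.2) y) x * P x ij.1 ij.2)).
  apply: eq_bigr => ij _; rewrite -mulr_suml div_Kgrad_entry//.
  exact: subset_Omega.
rewrite (@int_by_parts_sum _
  (fun ijk y => K y * pd ijk.2 (fun z => Q z ijk.1.1 ijk.1.2) y)
  (fun ijk x => P x ijk.1.1 ijk.1.2) snd); last 3 first.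
- by move=> ijk; exact: (pC1M KC (pC1_pd_entry _ _ _ QC)).
- by move=> ijk; exact: PC.
- by move=> ijk; exact: PQ0.
congr (- _); apply: int_eq => // x Ox; have cOx := subset_Omega Ox.
rewrite -(pair_bigA _ (fun (ij : 'I_d * 'I_d) k =>
  K x * pd k (fun z => Q z ij.1 ij.2) x * pd k (fun y => P y ij.1 ij.2) x)).
rewrite exchange_big mulr_sumr; apply: eq_bigr => k _.
rewrite ddotE pair_bigA mulr_sumr; apply: eq_bigr => ij _.
have QijC i j := pC1_entry i j QC.1.
by rewrite -mulrA (pd_entry_pC1 k _ _ QijC cOx) (pd_entry_pC1 k _ _ PC cOx).
Qed.

End IntegrationByParts.

(** * Matrix-valued fields *)

Section MatrixFields.
Context {R : realType} {d : nat} (m : model R d).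
Local Notation pC1 := (partially_C1 m).
Local Notation bc := (bounded_continuous m).

Definition bounded_continuous_mx (p q : nat) (P : 'rV[R]_d -> 'M[R]_(p, q)) :=
  forall i j, bc (fun x => P x i j).
Local Notation bcm := bounded_continuous_mx.

Lemma bcm_cst (p q : nat) (P : 'M[R]_(p, q)) : bcm (fun=> P).
Proof. by move=> i j; exact: bc_cst. Qed.

Lemma bcmD (p q : nat) (P Q : 'rV[R]_d -> 'M[R]_(p, q)) :
  bcm P -> bcm Q -> bcm (fun x => P x + Q x).
Proof.
move=> bP bQ i j; apply: bc_eq (bcD (bP i j) (bQ i j)) => x _.
by rewrite mxE.
Qed.

Lemma bcmN (p q : nat) (P : 'rV[R]_d -> 'M[R]_(p, q)) :
  bcm P -> bcm (fun x => - P x).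
Proof.
by move=> bP i j; apply: bc_eq (bcN (bP i j)) => x _; rewrite mxE.
Qed.

Lemma bcmB (p q : nat) (P Q : 'rV[R]_d -> 'M[R]_(p, q)) :
  bcm P -> bcm Q -> bcm (fun x => P x - Q x).
Proof. by move=> bP bQ; apply: bcmD => //; exact: bcmN. Qed.

Lemma bcmZ (p q : nat) f (P : 'rV[R]_d -> 'M[R]_(p, q)) :
  bc f -> bcm P -> bcm (fun x => f x *: P x).
Proof.
by move=> bf bP i j; apply: bc_eq (bcM bf (bP i j)) => x _; rewrite mxE.
Qed.

Lemma bcm_mul (p q r : nat) (P : 'rV[R]_d -> 'M[R]_(p, q))
    (Q : 'rV[R]_d -> 'M[R]_(q, r)) :
  bcm P -> bcm Q -> bcm (fun x => P x *m Q x).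
Proof.
move=> bP bQ i j.
apply: bc_eq (bc_sum _ (fun k => bcM (bP i k) (bQ k j))) => x _.
by rewrite mxE.
Qed.

Lemma bcm_trmx (p q : nat) (P : 'rV[R]_d -> 'M[R]_(p, q)) :
  bcm P -> bcm (fun x => (P x)^T).
Proof. by move=> bP i j; apply: bc_eq (bP j i) => x _; rewrite mxE. Qed.

Lemma bcm_scalar (n : nat) f : bc f -> bcm (fun x => (f x)%:M : 'M[R]_n).
Proof.
move=> bf i j; apply: bc_eq (bcM bf (bc_cst m ((i == j)%:R : R))) => x _.
by rewrite mxE mulr_natr.
Qed.

Lemma bcm_sum (p q : nat) (J : Type) (r : seq J)
    (P : J -> 'rV[R]_d -> 'M[R]_(p, q)) :
  (forall j, bcm (P j)) -> bcm (fun x => \sum_(j <- r) P j x).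
Proof.
move=> bP i j; apply: bc_eq (bc_sum r (fun k => bP k i j)) => x _.
by rewrite summxE.
Qed.

Lemma bc_mxtrace (n : nat) (P : 'rV[R]_d -> 'M[R]_n) :
  bcm P -> bc (fun x => \tr (P x)).
Proof. by move=> bP; apply: (bc_sum _ (fun i => bP i i)). Qed.

Lemma bc_ddot (p q : nat) (P Q : 'rV[R]_d -> 'M[R]_(p, q)) :
  bcm P -> bcm Q -> bc (fun x => ddot (P x) (Q x)).
Proof. by move=> bP bQ; apply/bc_mxtrace/bcm_mul => //; exact: bcm_trmx. Qed.

Lemma bcm_entries (p q : nat) (P : 'rV[R]_d -> 'M[R]_(p, q)) :
  (forall i j, pC1 (fun x => P x i j)) -> bcm P.
Proof. by move=> PC i j; apply: partially_C1_bc. Qed.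

Lemma bcm_pd (p q : nat) (P : 'rV[R]_d -> 'M[R]_(p, q)) k :
  (forall i j, pC1 (fun x => P x i j)) -> bcm (pd k P).
Proof.
move=> PC i j; apply: bc_eq (partially_C1_pd_bc k (PC i j)) => x Ox.
by rewrite (pd_entry_pC1 k i j PC)//; exact: subset_Omega.
Qed.

Lemma bcm_tdiv (T : 'rV[R]_d -> 'M[R]_d) :
  (forall i j, pC1 (fun x => T x i j)) -> bcm (tdiv T).
Proof.
move=> TC i j.
apply: bc_eq (bc_sum _ (fun k => partially_C1_pd_bc k (TC j k))) => x _.
by rewrite mxE.
Qed.

Lemma bcm_grad (f : 'rV[R]_d -> R) : pC1 f -> bcm (grad f).
Proof.
move=> fC i j; apply: bc_eq (partially_C1_pd_bc j fC) => x _.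
by rewrite mxE.
Qed.

Lemma bcm_vgrad (v : 'rV[R]_d -> 'rV[R]_d) :
  (forall k, pC1 (fun x => v x 0 k)) -> bcm (vgrad v).
Proof.
move=> vC i j; apply: bc_eq (partially_C1_pd_bc j (vC i)) => x _.
by rewrite mxE.
Qed.

Lemma bcm_symgrad (v : 'rV[R]_d -> 'rV[R]_d) :
  (forall k, pC1 (fun x => v x 0 k)) -> bcm (symgrad v).
Proof.
move=> /bcm_vgrad bv.
exact: (bcmZ (bc_cst m (2^-1 : R)) (bcmD bv (bcm_trmx bv))).
Qed.

Lemma bcm_skewgrad (v : 'rV[R]_d -> 'rV[R]_d) :
  (forall k, pC1 (fun x => v x 0 k)) -> bcm (skewgrad v).
Proof.
move=> /bcm_vgrad bv.
exact: (bcmZ (bc_cst m (2^-1 : R)) (bcmB bv (bcm_trmx bv))).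
Qed.

Lemma bcm_div_Kgrad (K : 'rV[R]_d -> R) (Q : 'rV[R]_d -> 'M[R]_d) :
  pC1 K -> C2 m Q -> bcm (div_Kgrad K Q).
Proof.
move=> KC QC i j; have KQC k := pC1M KC (pC1_pd_entry k i j QC).
apply: bc_eq (bc_sum _ (fun k => partially_C1_pd_bc k (KQC k))) => x Ox.
by rewrite (div_Kgrad_entry i j KC QC)//; exact: subset_Omega.
Qed.

Lemma bcm_within (p q : nat) (P : 'rV[R]_d -> 'M[R]_(p, q)) :
  {within closed_Omega m, continuous P} -> bcm P.
Proof.
move=> cP i j; apply: bc_within => x.
exact: (continuous_comp (cP x) (@coord_continuous R p q i j (P x))).
Qed.

(** For [coef_W], which contains the norm of the gradient of [phi] and need not be of class C^1. *)
Lemma bc_sqrt f : bc f -> bc (fun x => Num.sqrt (f x)).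
Proof.
move=> [cf [B fB]]; split.
  move=> x Ox; apply: (continuous_comp (cf x Ox)); exact: sqrt_continuous.
exists (Num.sqrt B) => x Ox; rewrite ger0_norm ?sqrtr_ge0//.
by apply: ler_wsqrtr; rewrite (le_trans (ler_norm _)) ?fB.
Qed.

End MatrixFields.

Local Notation "'bcm' m" := (bounded_continuous_mx m) (at level 10, m at level 9).

(** * Regularity of the coefficients, the discrete fields and the explicit terms *)

Section Coefficients.
Context {R : realType} {d : nat} (m : model R d) (hm : model_assumptions m).
Local Notation pC1 := (partially_C1 m).
Local Notation bc := (bounded_continuous m).

Lemma pC1_phi : pC1 (phi m).
Proof. by case: hm => _ /pC1_C1. Qed.

Let pC1_affine a b : pC1 (fun x => a * phi m x + b * (1 - phi m x)).
Proof.
apply: pC1D; apply: pC1Z; first exact: pC1_phi.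
by apply: pC1B; [exact: pC1_cst|exact: pC1_phi].
Qed.

Lemma pC1_b : pC1 (coef_b m).
Proof. by apply: pC1Z; apply: pC1B; [exact: pC1_cst|exact: pC1_phi]. Qed.
Lemma pC1_eta : pC1 (coef_eta m). Proof. exact: pC1_affine. Qed.
Lemma pC1_Gamma : pC1 (coef_Gamma m). Proof. exact: pC1_affine. Qed.
Lemma pC1_N : pC1 (coef_N m). Proof. exact: pC1_affine. Qed.
Lemma pC1_xi : pC1 (coef_xi m). Proof. exact: (pC1Z _ pC1_phi). Qed.
Lemma pC1_chi : pC1 (coef_chi m). Proof. exact: (pC1Z _ pC1_phi). Qed.
Lemma pC1_K : pC1 (coef_K m). Proof. exact: (pC1Z _ pC1_phi). Qed.
Lemma pC1_beta : pC1 (coef_beta m). Proof. exact: (pC1Z _ pC1_N). Qed.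
Lemma pC1_gamma : pC1 (coef_gamma m). Proof. exact: (pC1Z _ pC1_N). Qed.
Lemma pC1_alpha : pC1 (coef_alpha m).
Proof.
apply: pC1Z; apply: pC1B; first exact: pC1_cst.
by apply: pC1M; [exact: pC1_N|exact: pC1_cst].
Qed.

Lemma bc_W : bc (coef_W m).
Proof.
apply: bcM; first exact: bc_cst.
by apply: bc_sqrt; apply: bc_ddot; exact: (bcm_grad pC1_phi).
Qed.

Lemma bcm_Qstar : bcm m (Q_star m).
Proof. by case: hm => _ _ _ _ [cQ _]; exact: bcm_within. Qed.

Lemma bcm_f_bulk (Q : 'rV[R]_d -> 'M[R]_d) : bcm m Q -> bcm m (f_bulk m Q).
Proof.
move=> bQ; have bQQ := bcm_mul bQ bQ; have btQQ := bc_mxtrace bQQ.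
apply: bcmD; last first.
  by apply: bcmZ => //; apply: bcM => //; exact: (partially_C1_bc pC1_gamma).
apply: bcmB.
  by apply: bcmZ => //; exact: (partially_C1_bc pC1_alpha).
apply: bcmZ; first exact: (partially_C1_bc pC1_beta).
apply: bcmB => //; apply: bcm_scalar; apply: bcM => //; exact: bc_cst.
Qed.

End Coefficients.

Section States.
Context {R : realType} {d : nat} (m : model R d) (hm : model_assumptions m).
Context (s : state R d).
Context (vC : C2 m (vel s)) (QC : C2 m (Qten s)) (HC : C1 m (Hten s)).
Local Notation pC1 := (partially_C1 m).

Lemma pC1_vel k : pC1 (fun x => vel s x 0 k).
Proof. by case: vC => vC1 _; exact: pC1_entry. Qed.

Lemma pC1_Q i j : pC1 (fun x => Qten s x i j).
Proof. by case: QC => QC1 _; exact: pC1_entry. Qed.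

Lemma pC1_H i j : pC1 (fun x => Hten s x i j).
Proof. exact: pC1_entry. Qed.

Lemma bcm_vel : bcm m (vel s).
Proof. by apply: bcm_entries => i j; rewrite ord1; exact: pC1_vel. Qed.

Lemma bcm_Q : bcm m (Qten s). Proof. exact: (bcm_entries pC1_Q). Qed.
Lemma bcm_H : bcm m (Hten s). Proof. exact: (bcm_entries pC1_H). Qed.

Lemma pC1_symgrad i j : pC1 (fun x => symgrad (vel s) x i j).
Proof.
rewrite (_ : (fun x => _) = (fun x => 2^-1 * (pd j (fun y => vel s y 0 i) x +
    pd i (fun y => vel s y 0 j) x))); last first.
  by apply/funext => x; rewrite !mxE.
by apply: pC1Z; apply: pC1D; exact: (pC1_pd_entry _ _ _ vC).
Qed.

End States.

Section SmoothMatrixFields.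
Context {R : realType} {d : nat} (m : model R d).
Local Notation pC1 := (partially_C1 m).

Definition partially_C1_mx (p q : nat) (P : 'rV[R]_d -> 'M[R]_(p, q)) :=
  forall i j, pC1 (fun x => P x i j).
Local Notation pCm := partially_C1_mx.

Lemma pCmD (p q : nat) (P Q : 'rV[R]_d -> 'M[R]_(p, q)) :
  pCm P -> pCm Q -> pCm (fun x => P x + Q x).
Proof.
move=> PC QC i j; rewrite (_ : (fun x => _) = (fun x => P x i j + Q x i j)).
  exact: (pC1D (PC i j) (QC i j)).
by apply/funext => x; rewrite mxE.
Qed.

Lemma pCmZ (p q : nat) f (P : 'rV[R]_d -> 'M[R]_(p, q)) :
  pC1 f -> pCm P -> pCm (fun x => f x *: P x).
Proof.
move=> fC PC i j; rewrite (_ : (fun x => _) = (fun x => f x * P x i j)).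
  exact: (pC1M fC (PC i j)).
by apply/funext => x; rewrite mxE.
Qed.

Lemma pCmB (p q : nat) (P Q : 'rV[R]_d -> 'M[R]_(p, q)) :
  pCm P -> pCm Q -> pCm (fun x => P x - Q x).
Proof.
move=> PC QC i j; rewrite (_ : (fun x => _) = (fun x => P x i j - Q x i j)).
  exact: (pC1B (PC i j) (QC i j)).
by apply/funext => x; rewrite !mxE.
Qed.

Lemma pCm_mul (p q r : nat) (P : 'rV[R]_d -> 'M[R]_(p, q))
    (Q : 'rV[R]_d -> 'M[R]_(q, r)) :
  pCm P -> pCm Q -> pCm (fun x => P x *m Q x).
Proof.
move=> PC QC i j; rewrite (_ : (fun x => _) = (fun x => \sum_k P x i k * Q x k j)).
  exact: (pC1_sum _ (fun k => pC1M (PC i k) (QC k j))).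
by apply/funext => x; rewrite mxE.
Qed.

Lemma pCm_cst (p q : nat) (P : 'M[R]_(p, q)) : pCm (fun=> P).
Proof. by move=> i j; exact: pC1_cst. Qed.

Lemma pC1_ddot (p q : nat) (P Q : 'rV[R]_d -> 'M[R]_(p, q)) :
  pCm P -> pCm Q -> pC1 (fun x => ddot (P x) (Q x)).
Proof.
move=> PC QC; rewrite (_ : (fun x => _) = (fun x => \sum_i \sum_j P x i j * Q x i j)).
  exact: (pC1_sum _ (fun i => pC1_sum _ (fun j => pC1M (PC i j) (QC i j)))).
by apply/funext => x; rewrite ddotE.
Qed.

End SmoothMatrixFields.

Section ExplicitTerms.
Context {R : realType} {d : nat} (m : model R d) (hm : model_assumptions m).
Context (s : state R d).
Context (vC : C2 m (vel s)) (QC : C2 m (Qten s)) (HC : C1 m (Hten s)).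
Local Notation pC1 := (partially_C1 m).

(** [Sigma] enters [c_v] through its divergence; this is the place where derivatives of [Hten]
    occur. *)
Lemma pCm_Sigma : partially_C1_mx m (Sigma m s).
Proof.
have pQ : partially_C1_mx m (Qten s) := pC1_Q QC.
have pH : partially_C1_mx m (Hten s) := pC1_H HC.
have QH := pCm_mul pQ pH; have HQ := pCm_mul pH pQ.
apply: pCmD; last first.
  apply: pCmZ; first exact: (pC1Z _ (pC1_ddot pQ pH)).
  exact: (pCmD pQ (pCm_cst _ _)).
apply: pCmB; last by apply: pCmZ => //; exact: pC1_cst.
apply: pCmB; first exact: pCmB.
by apply: pCmZ; [exact: pC1_cst|exact: pCmD].
Qed.

Let bv := bcm_vel vC.
Let bQ := bcm_Q QC.
Let bH := bcm_H HC.

Lemma bcm_advect (p q : nat) (P : 'rV[R]_d -> 'M[R]_(p, q)) :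
  partially_C1_mx m P -> bcm m (advect (vel s) P).
Proof.
move=> PC; apply: (@bcm_sum R d m p q _ _ (fun k x => vel s x 0 k *: pd k P x)) => k.
by apply: bcmZ; [exact: bv|exact: bcm_pd].
Qed.

Lemma bcm_Sten : bcm m (Sten m s).
Proof.
have bD := bcm_symgrad (pC1_vel vC); have bO := bcm_skewgrad (pC1_vel vC).
apply: bcmB; last first.
  apply: bcmZ; last by apply: bcmD => //; exact: bcm_cst.
  by apply: bcM; [exact: bc_cst|exact: bc_ddot].
apply: bcmD; last by apply: bcmZ => //; exact: bc_cst.
apply: bcmD; first by apply: bcmB; exact: bcm_mul.
by apply: bcmZ; [exact: bc_cst|apply: bcmD; exact: bcm_mul].
Qed.

Lemma bcm_C_Q : bcm m (C_Q m s).
Proof.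
apply: bcmD; last exact: bcm_Sten.
by apply: bcmN; apply: bcm_advect; exact: pC1_Q.
Qed.

Lemma bcm_c_v : bcm m (c_v m s).
Proof.
apply: bcmB; last first.
  move=> i j; apply: bc_eq (bc_ddot bH (bcm_pd j (pC1_Q QC))) => x _.
  by rewrite mxE.
apply: bcmD; last by apply: bcm_tdiv; exact: pCm_Sigma.
apply: bcmN; apply: bcm_advect => i j; rewrite ord1; exact: pC1_vel.
Qed.

Lemma pCm_chiQ : partially_C1_mx m (fun x => coef_chi m x *: Qten s x).
Proof. by apply: pCmZ; [exact: pC1_chi|exact: pC1_Q]. Qed.

End ExplicitTerms.

(** * Traces along a segment and the pairing with [f_bulk] *)

Section BulkConvexity.
Context {R : realType} {d : nat} (m : model R d) (hm : model_assumptions m).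
Context (hd : d = 2%N \/ d = 3%N).
Local Notation bc := (bounded_continuous m).
Local Notation I := (int_Omega m).

Lemma trace_square_perturb (P Q : 'M[R]_d) (t : R) :
  \tr ((Q + t *: P) *m (Q + t *: P)) =
  \tr (Q *m Q) + t * (2 * \tr (Q *m P)) + t ^+ 2 * \tr (P *m P).
Proof.
rewrite !mulmxDl !mulmxDr -!scalemxAl -!scalemxAr !mxtraceD !mxtraceZ.
rewrite [\tr (P *m Q)]mxtrace_mulC; ring.
Qed.

(** Cyclic invariance of the trace merges the eight words of length three in [P] and [Q] into
    four. *)
Lemma trace_cube_perturb (P Q : 'M[R]_d) (t : R) :
  \tr ((Q + t *: P) *m (Q + t *: P) *m (Q + t *: P)) =
  \tr (Q *m Q *m Q) + t * (3 * \tr (Q *m Q *m P)) +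
  t ^+ 2 * (3 * \tr (Q *m P *m P)) + t ^+ 3 * \tr (P *m P *m P).
Proof.
rewrite !(mulmxDl, mulmxDr) -!(scalemxAl, scalemxAr) !(mxtraceD, mxtraceZ).
have -> : \tr (Q *m P *m Q) = \tr (Q *m Q *m P).
  by rewrite mxtrace_mulC mulmxA.
have -> : \tr (P *m Q *m Q) = \tr (Q *m Q *m P).
  by rewrite -mulmxA mxtrace_mulC.
have -> : \tr (P *m P *m Q) = \tr (Q *m P *m P).
  by rewrite mxtrace_mulC mulmxA.
have -> : \tr (P *m Q *m P) = \tr (Q *m P *m P).
  by rewrite -mulmxA mxtrace_mulC.
ring.
Qed.

Lemma sqr_normL2 (p q : nat) (P : 'rV[R]_d -> 'M[R]_(p, q)) :
  normL2 m P ^+ 2 = I (fun x => sqnorm (P x)).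
Proof.
by rewrite sqr_sqrtr//; apply: (int_ge0 hd) => x _; exact: sqnorm_ge0.
Qed.

(** The multiple of the identity in [f_bulk] pairs to zero with a trace-free matrix. What remains is
    the derivative of the bulk density at [Q x] in direction [P x]. *)
Lemma ddot_f_bulk (Q P : 'rV[R]_d -> 'M[R]_d) x :
  M0 (Q x) -> M0 (P x) ->
  ddot (f_bulk m Q x) (P x) =
  coef_alpha m x * \tr (Q x *m P x) - coef_beta m x * \tr (Q x *m Q x *m P x)
  + coef_gamma m x * \tr (Q x *m Q x) * \tr (Q x *m P x).
Proof.
move=> [sQ tQ] [sP tP]; rewrite /f_bulk !ddotEs.
have -> : ddot (Q x) (P x) = \tr (Q x *m P x) by rewrite /ddot sQ.
have -> : ddot (Q x *m Q x) (P x) = \tr (Q x *m Q x *m P x).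
  by rewrite /ddot trmx_mul sQ.
rewrite {1}/ddot tr_scalar_mx mul_scalar_mx mxtraceZ tP mulr0 subr0.
by [].
Qed.

End BulkConvexity.

(** * Bulk energy *)

(** For a quartic lying below its chord on [0, 1], the slope at 0 is at most that of the chord.
    Otherwise, with excess [e], dividing by [t] gives [e + t * (c2 + ...) <= 0], which fails for
    small [t]. *)
Lemma tangent_le_chord (R : realFieldType) (c0 c1 c2 c3 c4 B : R) :
  (forall t, 0 <= t <= 1 ->
    c0 + t * c1 + t ^+ 2 * c2 + t ^+ 3 * c3 + t ^+ 4 * c4 <=
    t * B + (1 - t) * c0) ->
  c1 <= B - c0.
Proof.
move=> H; rewrite leNgt; apply/negP => lt1.
pose e := c1 - (B - c0); pose M := `|c2| + `|c3| + `|c4|.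
have e0 : 0 < e by rewrite subr_gt0.
have M0 : 0 <= M by rewrite !addr_ge0.
have D0 : 0 < e + M + 1 by lra.
(* Chosen so that [t <= 1] and [t * M < e]; the higher-order terms, bounded below by [- t * M],
   cannot compensate [e]. *)
pose t := e / (e + M + 1).
have t0 : 0 < t by rewrite divr_gt0.
have t1 : t <= 1 by rewrite ler_pdivrMr// mul1r; lra.
have tD : t * (e + M + 1) = e by rewrite divfK// gt_eqF.
have := H t; rewrite (ltW t0) t1 => /(_ isT) Ht.
have {Ht} : t * (e + t * (c2 + t * c3 + t ^+ 2 * c4)) <= 0.
  rewrite -(lerD2l (t * (B - c0) + c0)) addr0 /e.
  by move: Ht; congr (_ <= _); ring.
rewrite pmulr_rle0// => He.
have : - M <= c2 + t * c3 + t ^+ 2 * c4.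
  have h2 := ler_norm (- c2); have h3 := ler_norm (- c3); have h4 := ler_norm (- c4).
  rewrite !normrN in h2 h3 h4.
  have g3 : - `|c3| <= t * c3.
    by rewrite lerNl (le_trans (ler_norm _))// normrN normrM (gtr0_norm t0) ler_piMl.
  have g4 : - `|c4| <= t ^+ 2 * c4.
    rewrite lerNl (le_trans (ler_norm _))// normrN normrM ger0_norm ?exprn_ge0 ?(ltW t0)//.
    by rewrite ler_piMl// exprn_ile1 ?(ltW t0).
  rewrite /M; lra.
move=> /(ler_wpM2l (ltW t0)) tM; nra.
Qed.

Section BulkConvexity.
Context {R : realType} {d : nat} (m : model R d) (hm : model_assumptions m).
Context (hd : d = 2%N \/ d = 3%N).
Local Notation bc := (bounded_continuous m).
Local Notation I := (int_Omega m).

Lemma convex_conv (kappa M t : R) (Q Q' : 'rV[R]_d -> 'M[R]_d) :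
  convex_function (M0_fields_bounded_by m M) (F_kappa m kappa) ->
  0 <= t <= 1 ->
  M0_fields_bounded_by m M Q -> M0_fields_bounded_by m M Q' ->
  F_kappa m kappa (fun x => Q x + t *: (Q' x - Q x)) <=
  t * F_kappa m kappa Q' + (1 - t) * F_kappa m kappa Q.
Proof.
move=> cvx /andP[t0 t1] MQ MQ'.
have cvxt : F_kappa m kappa (t *: Q' + (1 - t) *: Q) <=
    t * F_kappa m kappa Q' + (1 - t) * F_kappa m kappa Q.
  (* The parameter of [convex_function] weights the first point, hence the order [Q'], [Q]. *)
  exact: (cvx (Itv01 t0 t1) Q' Q (mem_set MQ') (mem_set MQ)).
apply: le_trans cvxt; rewrite le_eqVlt; apply/orP; left; apply/eqP.
congr (F_kappa m kappa _); apply/funext => x.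
rewrite -[RHS]/(t *: Q' x + (1 - t) *: Q x) scalerBl scale1r scalerBr.
by rewrite [RHS]addrC -addrA; congr (_ + _); rewrite addrC.
Qed.

Lemma F_kappa_int (kappa : R) (Q : 'rV[R]_d -> 'M[R]_d) : bcm m Q ->
  F_kappa m kappa Q = I (fun x => kappa / 2 * sqnorm (Q x) -
    (coef_alpha m x / 2 * \tr (Q x *m Q x)
    - coef_beta m x / 3 * \tr (Q x *m Q x *m Q x)
    + coef_gamma m x / 4 * \tr (Q x *m Q x) ^+ 2)).
Proof.
move=> bQ; have bQQ := bcm_mul bQ bQ.
have ba := bc_mxtrace bQQ; have b3 := bc_mxtrace (bcm_mul bQQ bQ).
have bal := partially_C1_bc (pC1_alpha hm).
have bbe := partially_C1_bc (pC1_beta hm).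
have bga := partially_C1_bc (pC1_gamma hm).
have bn : bc (fun x => sqnorm (Q x)) by exact: bc_ddot.
rewrite /F_kappa /F_bulk sqr_normL2// -(intZ hd _ bn) -(intB hd)//; solve_bc.
Qed.

Lemma sqnorm_sym (P : 'M[R]_d) : P^T = P -> sqnorm P = \tr (P *m P).
Proof. by rewrite /sqnorm /ddot => ->. Qed.

Lemma bulk_energy_le (kappa M : R) (Q Q' : 'rV[R]_d -> 'M[R]_d) :
  convex_function (M0_fields_bounded_by m M) (F_kappa m kappa) ->
  M0_fields_bounded_by m M Q -> M0_fields_bounded_by m M Q' ->
  F_bulk m Q' - F_bulk m Q <=
  I (fun x => ddot (f_bulk m Q x) (Q' x - Q x)) +
  kappa / 2 * I (fun x => sqnorm (Q' x - Q x)).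
Proof.
move=> cvx MQ MQ'; have [[QC _] M0Q] := MQ; have [[QC' _] M0Q'] := MQ'.
pose P x := Q' x - Q x.
have M0P x : closed_Omega m x -> M0 (P x).
  move=> Ox; have [[sQ tQ] _] := M0Q x Ox; have [[sQ' tQ'] _] := M0Q' x Ox.
  by split; [rewrite /P linearB /= sQ sQ'|rewrite /P linearB /= tQ tQ' subrr].
have bQ : bcm m Q by apply: bcm_entries => i j; exact: pC1_entry.
have bQ' : bcm m Q' by apply: bcm_entries => i j; exact: pC1_entry.
have bP : bcm m P by exact: bcmB.
pose al := coef_alpha m; pose be := coef_beta m; pose ga := coef_gamma m.
pose a x := \tr (Q x *m Q x); pose b x := \tr (Q x *m P x); pose c x := \tr (P x *m P x).
pose B1 x := \tr (Q x *m Q x *m P x); pose B2 x := \tr (Q x *m P x *m P x).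
pose B0 x := \tr (Q x *m Q x *m Q x); pose B3 x := \tr (P x *m P x *m P x).
(* [c0] to [c4] are the coefficients of the powers of [t] in the integrand of [F_kappa] at
   [Q + t *: P]. The first-order one, [c1], carries the pairing with [f_bulk]. *)
pose c0 x := kappa / 2 * a x -
  (al x / 2 * a x - be x / 3 * B0 x + ga x / 4 * a x ^+ 2).
pose c1 x := kappa * b x - ddot (f_bulk m Q x) (P x).
pose c2 x := kappa / 2 * c x -
  (al x / 2 * c x - be x * B2 x + ga x / 2 * (a x * c x) + ga x * b x ^+ 2).
pose c3 x := be x / 3 * B3 x - ga x * (b x * c x).
pose c4 x := - (ga x / 4 * c x ^+ 2).
have bal : bc al by exact/partially_C1_bc/pC1_alpha.
have bbe : bc be by exact/partially_C1_bc/pC1_beta.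
have bga : bc ga by exact/partially_C1_bc/pC1_gamma.
have ba : bc a by apply/bc_mxtrace/bcm_mul.
have bb : bc b by apply/bc_mxtrace/bcm_mul.
have bcc : bc c by apply/bc_mxtrace/bcm_mul.
have bB0 : bc B0 by apply/bc_mxtrace/bcm_mul => //; exact: bcm_mul.
have bB1 : bc B1 by apply/bc_mxtrace/bcm_mul => //; exact: bcm_mul.
have bB2 : bc B2 by apply/bc_mxtrace/bcm_mul => //; exact: bcm_mul.
have bB3 : bc B3 by apply/bc_mxtrace/bcm_mul => //; exact: bcm_mul.
have bf : bc (fun x => ddot (f_bulk m Q x) (P x)).
  by apply: bc_ddot => //; exact: bcm_f_bulk.
have b0 : bc c0.
  by rewrite /c0; solve_bc.
have b1 : bc c1.
  by rewrite /c1; solve_bc.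
have b2 : bc c2.
  by rewrite /c2; solve_bc.
have b3 : bc c3.
  by rewrite /c3; solve_bc.
have b4 : bc c4.
  by rewrite /c4; solve_bc.
have FtE t : F_kappa m kappa (fun x => Q x + t *: (Q' x - Q x)) =
    I c0 + t * I c1 + t ^+ 2 * I c2 + t ^+ 3 * I c3 + t ^+ 4 * I c4.
  rewrite F_kappa_int; last by apply: bcmD => //; apply: bcmZ => //; exact: bc_cst.
  transitivity (I (fun x =>
      c0 x + t * c1 x + t ^+ 2 * c2 x + t ^+ 3 * c3 x + t ^+ 4 * c4 x)).
    apply: int_eq => // x /subset_Omega Ox.
    have [sQ _] := (M0Q x Ox).1; have [sP _] := M0P x Ox.
    rewrite sqnorm_sym -/(P x); last by rewrite linearD /= linearZ /= sQ sP.
    rewrite trace_square_perturb trace_cube_perturb /c0 /c1 /c2 /c3 /c4.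
    rewrite ddot_f_bulk//; [|exact: (M0Q x Ox).1|exact: M0P].
    rewrite -/(a x) -/(b x) -/(c x) -/(B0 x) -/(B1 x) -/(B2 x) -/(B3 x).
    rewrite -/(al x) -/(be x) -/(ga x).
    by field.
  by rewrite !(intD hd, intZ hd); [reflexivity|solve_bc..].
have F0E : F_kappa m kappa Q = I c0.
  have := FtE 0; rewrite !expr0n /= !mul0r !addr0 => <-.
  by congr (F_kappa m kappa _); apply/funext => x; rewrite scale0r addr0.
have c1le : I c1 <= F_kappa m kappa Q' - I c0.
  apply: (@tangent_le_chord _ _ _ (I c2) (I c3) (I c4)) => t t01.
  by rewrite -FtE -F0E; exact: (convex_conv cvx).
have c1E : I c1 = kappa * I b - I (fun x => ddot (f_bulk m Q x) (P x)).
  by rewrite (intB hd) ?(intZ hd)//; solve_bc.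
(* Makes the stabilization exact: [kappa / 2] times the difference of the squared norms, minus the
   first-order term [kappa * I b], is [kappa / 2] times the squared norm of [P]. *)
have nE : I (fun x => sqnorm (Q' x)) =
    I (fun x => sqnorm (Q x)) + 2 * I b + I (fun x => sqnorm (P x)).
  have n1 : bc (fun x => sqnorm (Q x)) by exact: bc_ddot.
  have n2 : bc (fun x => sqnorm (P x)) by exact: bc_ddot.
  rewrite -(intZ hd)// -!(intD hd)//; [|solve_bc..].
  apply: int_eq => // x /subset_Omega Ox.
  have [sQ _] := (M0Q x Ox).1; have [sP _] := M0P x Ox.
  have -> : Q' x = Q x + 1 *: P x by rewrite scale1r addrC subrK.
  rewrite !sqnorm_sym//; last by rewrite linearD /= linearZ /= sQ sP.
  by rewrite trace_square_perturb /b; ring.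
move: c1le; rewrite c1E -F0E /F_kappa !sqr_normL2// nE.
rewrite -/(P _).
set X := I (fun x => ddot _ _); set Y := I (fun x => sqnorm (P x)).
set Z := I (fun x => sqnorm (Q x)).
lra.
Qed.

End BulkConvexity.

(** * Energy balance *)

(** The scalar skeleton of the energy estimate. [V], [L], [A], [F] stand for the kinetic, elastic,
    anchoring and bulk energies, with primes at the new level; [T] is the pairing of [Q' - Q] with
    [- H']; [EI], [AI], [FI] are its elastic, anchoring and bulk parts; [X1] to [X4] are the
    products with explicit terms. Of [kappa * N], one half pays for the bulk inequality and the
    other is dropped. *)
Lemma energy_arithmetic (R : realFieldType) (tau kappa z w : R)
    (E E' V V' L L' A A' F F' T EI AI FI N : R)
    (Eta B Gam DV DG CH XI X1 X2 X3 X4 nEta nB nGam nDV nDG ip : R) :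
  E' = 2^-1 * V' + 2^-1 * L' + 2^-1 * A' + F' ->
  E = 2^-1 * V + 2^-1 * L + 2^-1 * A + F ->
  2^-1 * V' - 2^-1 * V + 2^-1 * DV =
    tau * (- (2 * Eta) - B + z * X1 - w * X2 + CH) ->
  T = tau * (- Gam + z * X3 - w * X4 - XI) ->
  T = EI + AI + kappa * N + FI ->
  EI = 2^-1 * L' - 2^-1 * L + 2^-1 * DG ->
  2^-1 * A' - 2^-1 * A <= AI ->
  F' - F <= FI + kappa / 2 * N ->
  0 <= kappa / 2 * N ->
  z * (X1 + X3) = w * (X2 + X4) ->
  nEta = Eta -> nB = B -> nGam = Gam -> nDV = DV -> nDG = DG -> ip = CH - XI ->
  E' - E <= - (2 * tau * nEta) - tau * nB - tau * nGam - 2^-1 * nDV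
    - 2^-1 * nDG + tau * ip.
Proof.
move=> -> -> mom ten ela elid anch bulk N0 cancel -> -> -> -> -> ->.
have tcancel : tau * (z * X1 - w * X2) + tau * (z * X3 - w * X4) = 0.
  transitivity (tau * (z * (X1 + X3) - w * (X2 + X4))); first by ring.
  by rewrite cancel subrr mulr0.
have mom' : 2^-1 * V' - 2^-1 * V + 2^-1 * DV =
    tau * (- (2 * Eta) - B + CH) + tau * (z * X1 - w * X2).
  by rewrite mom; ring.
have ten' : T = tau * (- Gam - XI) + tau * (z * X3 - w * X4).
  by rewrite ten; ring.
lra.
Qed.

Lemma sum_expand (R : realFieldType) (J : finType) (K : R) (e a b c : J -> R) :
  (forall j, e j = 2^-1 * a j - 2^-1 * b j + 2^-1 * c j) ->
  K * \sum_j e j = 2^-1 * (K * \sum_j a j) - 2^-1 * (K * \sum_j b j) +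
    2^-1 * (K * \sum_j c j).
Proof.
move=> eE; rewrite (eq_bigr _ (fun j _ => eE j)) big_split sumrB /= -!mulr_sumr.
by ring.
Qed.

Section EnergyBalance.
Context {R : realType} {d : nat} (m : model R d) (hm : model_assumptions m).
Context (hd : d = 2%N \/ d = 3%N).
Context (s s' : state R d) (tau kappa z w : R) (tau0 : 0 < tau).
Context (vC : C2 m (vel s)) (QC : C2 m (Qten s)) (HC : C1 m (Hten s)).
Context (vC' : C2 m (vel s')) (QC' : C2 m (Qten s')) (HC' : C1 m (Hten s')).
Context (pC' : C1 m (pres s' : 'rV[R]_d -> R^o)).
Context (M0Q : forall x, closed_Omega m x -> M0 (Qten s x)).
Context (M0Q' : forall x, closed_Omega m x -> M0 (Qten s' x)).
Context (v0' : forall x, bd_Omega m x -> vel s' x = 0).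
Context (step : scheme_step m tau kappa z w s s').
Local Notation bc := (bounded_continuous m).
Local Notation I := (int_Omega m).
Local Notation v := (vel s).
Local Notation v' := (vel s').
Local Notation Q := (Qten s).
Local Notation Q' := (Qten s').
Local Notation H' := (Hten s').
Local Notation D' := (symgrad (vel s')).

Let side0 : 0 < side m. Proof. by case: hm => -[]. Qed.

Let bv := bcm_vel vC.
Let bQ := bcm_Q QC.
Let bH := bcm_H HC.
Let bv' := bcm_vel vC'.
Let bQ' := bcm_Q QC'.
Let bH' := bcm_H HC'.
Let bD' := bcm_symgrad (pC1_vel vC').

Lemma momentum_balance :
  2^-1 * I (fun x => sqnorm (v' x)) - 2^-1 * I (fun x => sqnorm (v x)) +
  2^-1 * I (fun x => sqnorm (v' x - v x)) =
  tau * (- (2 * I (fun x => coef_eta m x * sqnorm (D' x)))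
    - I (fun x => coef_b m x * sqnorm (v' x))
    + z * inner m (g_v s') (c_v m s) - w * inner m (g_v s') (g_v s)
    + I (fun x => coef_chi m x * ddot (Q x) (D' x))).
Proof.
have etaDC i j : partially_C1 m (fun y => (coef_eta m y *: D' y) i j).
  by apply: pCmZ; [exact: pC1_eta|exact: pC1_symgrad].
have chiQC := pCm_chiQ hm QC.
have bp : bc (fun x => ddot (grad (pres s') x) (v' x)).
  by apply: bc_ddot => //; apply: bcm_grad; exact: pC1_C1.
have bt : bc (fun x => ddot (tdiv (fun y => coef_eta m y *: D' y) x) (v' x)).
  exact: (bc_ddot (bcm_tdiv etaDC) bv').
have bf : bc (fun x => ddot (tdiv (fun y => coef_chi m y *: Q y) x) (v' x)).
  exact: (bc_ddot (bcm_tdiv chiQC) bv').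
have bb : bc (coef_b m) by exact/partially_C1_bc/pC1_b.
have bn' : bc (fun x => sqnorm (v' x)) by exact: bc_ddot.
have bn : bc (fun x => sqnorm (v x)) by exact: bc_ddot.
have bg : bc (fun x => ddot (v' x) (v x)) by exact: bc_ddot.
have bcv' : bc (fun x => ddot (v' x) (c_v m s x)) by exact: bc_ddot (bcm_c_v vC QC HC).
have bdn : bc (fun x => sqnorm (v' x - v x)).
  by apply: bc_ddot; exact: bcmB.
have pE : I (fun x => ddot (grad (pres s') x) (v' x)) = 0.
  apply: int_grad_ddot => //; first exact: pC1_C1.
    exact: pC1_vel.
  by move=> x Ox; case: step => /(_ x Ox)[].
have tE : I (fun x => ddot (tdiv (fun y => coef_eta m y *: D' y) x) (v' x)) =
    - I (fun x => coef_eta m x * sqnorm (D' x)).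
  rewrite (int_tdiv_ddot hd side0 etaDC (pC1_vel vC') v0').
  congr (- _); apply: int_eq => // x _; rewrite ddotZl /sqnorm.
  rewrite [in RHS]/symgrad ddot_symmetric //.
  by rewrite /symgrad linearZ /= linearD /= trmxK addrC.
have fE : I (fun x => ddot (tdiv (fun y => coef_chi m y *: Q y) x) (v' x)) =
    - I (fun x => coef_chi m x * ddot (Q x) (D' x)).
  rewrite (int_tdiv_ddot hd side0 chiQC (pC1_vel vC') v0').
  congr (- _); apply: int_eq => // x /subset_Omega /M0Q[sQ _].
  by rewrite ddotZl ddot_symmetric.
transitivity (I (fun x => tau * (
    - ddot (grad (pres s') x) (v' x)
    + 2 * ddot (tdiv (fun y => coef_eta m y *: D' y) x) (v' x)
    - coef_b m x * sqnorm (v' x)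
    + z * ddot (v' x) (c_v m s x) - w * ddot (v' x) (v x)
    - ddot (tdiv (fun y => coef_chi m y *: Q y) x) (v' x)))); last first.
  rewrite !(intD hd, intB hd, intZ hd, intN hd); [|solve_bc..].
  by rewrite pE tE fE /inner; ring.
rewrite -!(intZ hd); [|solve_bc..].
rewrite -(intB hd); [|solve_bc..].
rewrite -(intD hd); [|solve_bc..].
apply: int_eq => // x Ox; case: step => /(_ x Ox)[eqv _ _ _] _ _.
have : ddot (tau^-1 *: (v' x - v x)) (v' x) * tau =
    2^-1 * sqnorm (v' x) - 2^-1 * sqnorm (v x) + 2^-1 * sqnorm (v' x - v x).
  rewrite /sqnorm !ddotEs (ddotC (v' x) (v x)); field.
  by rewrite gt_eqF.
move=> <-; rewrite eqv /f_v /g_v (ddotC (v' x) (v x)) (ddotC (v' x) (c_v m s x)).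
move: (c_v m s x) (grad _ x) (tdiv _ x) (tdiv _ x) => c g t1 t2.
by rewrite !ddotEs /sqnorm; ring.
Qed.

(** The left side is computed twice, here from the evolution of [Q] and in [elastic_balance] from
    the formula for [H']; equating the two results eliminates it. *)
Lemma tensor_balance :
  I (fun x => ddot (Q' x - Q x) (- H' x)) =
  tau * (- I (fun x => coef_Gamma m x * sqnorm (H' x))
    + z * inner m (G_Q s') (C_Q m s) - w * inner m (G_Q s') (G_Q s)
    - I (fun x => coef_xi m x * ddot (Q x) (H' x))).
Proof.
have bG : bc (coef_Gamma m) by exact/partially_C1_bc/pC1_Gamma.
have bxi : bc (coef_xi m) by exact/partially_C1_bc/pC1_xi.
have bn' : bc (fun x => sqnorm (H' x)) by exact: bc_ddot.
have bGG : bc (fun x => ddot (G_Q s' x) (G_Q s x)).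
  by apply: bc_ddot; exact: bcmN.
have bGC : bc (fun x => ddot (G_Q s' x) (C_Q m s x)).
  exact: bc_ddot (bcmN bH') (bcm_C_Q vC QC).
have bQH : bc (fun x => ddot (Q x) (H' x)) by exact: bc_ddot.
rewrite /inner -!(intZ hd); [|solve_bc..].
rewrite -!(intN hd); [|solve_bc..].
rewrite -!(intD hd); [|solve_bc..].
rewrite -(intZ hd); [|solve_bc..].
apply: int_eq => // x Ox; case: step => /(_ x Ox)[_ _ eqQ _] _ _.
have -> : ddot (Q' x - Q x) (- H' x) = tau * ddot (tau^-1 *: (Q' x - Q x)) (- H' x).
  by rewrite ddotZl mulrA divff ?mul1r// gt_eqF.
rewrite eqQ /F_Q /G_Q (ddotC _ (C_Q m s x)) (ddotC _ (- Hten s x)).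
by move: (C_Q m s x) => c; rewrite !ddotEs /sqnorm; ring.
Qed.

(** One condition for both types of boundary data: Dirichlet data annihilate the last factor,
    Neumann data the normal derivative. *)
Context (face0 : forall i j k, vanishes_on_faces m k
  (fun x => coef_K m x * pd k (fun y => Q' y i j) x * (Q' x i j - Q x i j))).

Lemma elastic_balance :
  I (fun x => ddot (Q' x - Q x) (- H' x)) =
  I (fun x => coef_K m x * \sum_k
      ddot (pd k Q' x) (pd k (fun y => Q' y - Q y) x)) +
  I (fun x => coef_W m x * ddot (Q' x - Q_star m x) (Q' x - Q x)) +
  kappa * I (fun x => sqnorm (Q' x - Q x)) +
  I (fun x => ddot (f_bulk m Q x) (Q' x - Q x)).
Proof.
have dQC : partially_C1_mx m (fun x => Q' x - Q x).
  by apply: pCmB; exact: pC1_Q.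
have bd : bcm m (fun x => Q' x - Q x) by exact: bcmB.
have bK : bc (fun x => ddot (div_Kgrad (coef_K m) Q' x) (Q' x - Q x)).
  by apply: bc_ddot bd; exact: (bcm_div_Kgrad (pC1_K hm) QC').
have bW := bc_W hm.
have bWd : bc (fun x => ddot (Q' x - Q_star m x) (Q' x - Q x)).
  by apply: bc_ddot bd; apply: bcmB => //; exact: bcm_Qstar.
have bdn : bc (fun x => sqnorm (Q' x - Q x)) by exact: bc_ddot.
have bf : bc (fun x => ddot (f_bulk m Q x) (Q' x - Q x)).
  by apply: bc_ddot bd; exact: bcm_f_bulk.
rewrite -[X in X + _ + _ + _]opprK.
rewrite -(int_div_Kgrad_ddot hd side0 (pC1_K hm) QC' dQC); last first.
  move=> i j k x xi xk; rewrite -[RHS](face0 i j xi xk); congr (_ * _).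
  by rewrite !mxE.
rewrite -(intN hd); [|solve_bc..].
rewrite -(intZ hd); [|solve_bc..].
rewrite -!(intD hd); [|solve_bc..].
apply: int_eq => // x Ox; case: step => /(_ x Ox)[_ _ _ eqH] _ _.
rewrite eqH ddotC /sqnorm.
move: (div_Kgrad _ _ x) (f_bulk _ _ x) (Q' x - Q x) (Q' x - Q_star m x) => k f e g.
by rewrite !ddotEs; ring.
Qed.

Let sqnorm_expand (p q : nat) (A B : 'M[R]_(p, q)) :
  ddot A (A - B) = 2^-1 * sqnorm A - 2^-1 * sqnorm B + 2^-1 * sqnorm (A - B).
Proof. by rewrite /sqnorm !ddotEs (ddotC B A); field. Qed.

Let pdQ k x : closed_Omega m x ->
  pd k (fun y => Q' y - Q y) x = pd k Q' x - pd k Q x.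
Proof.
move=> Ox; apply/matrixP => i j.
have QE i' j' : (fun y => (Q' y - Q y) i' j') = (fun y => Q' y i' j' - Q y i' j').
  by apply/funext => y; rewrite !mxE.
have dQC : partially_C1_mx m (fun x => Q' x - Q x).
  by apply: pCmB; exact: pC1_Q.
have QijC := pC1_Q QC; have QijC' := pC1_Q QC'.
rewrite (pd_entry_pC1 k i j dQC Ox) QE (pdB k (QijC' i j) (QijC i j) Ox) 2!mxE.
by rewrite (pd_entry_pC1 k i j QijC' Ox) (pd_entry_pC1 k i j QijC Ox).
Qed.

Definition elastic_energy (u : state R d) : R :=
  I (fun x => coef_K m x * \sum_k sqnorm (pd k (Qten u) x)).

Definition anchoring_energy (u : state R d) : R :=
  I (fun x => coef_W m x * sqnorm (Qten u x - Q_star m x)).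

Lemma elastic_identity :
  I (fun x => coef_K m x * \sum_k
      ddot (pd k Q' x) (pd k (fun y => Q' y - Q y) x)) =
  2^-1 * elastic_energy s' - 2^-1 * elastic_energy s +
  2^-1 * I (fun x => coef_K m x * \sum_k sqnorm (pd k (fun y => Q' y - Q y) x)).
Proof.
have bK := partially_C1_bc (pC1_K hm).
have bgrad (T : 'I_d -> 'rV[R]_d -> 'M[R]_d) : (forall k, bcm m (T k)) ->
    bc (fun x => \sum_k sqnorm (T k x)).
  by move=> bT; apply: (bc_sum _ (fun k => bc_ddot (bT k) (bT k))).
have dQC : partially_C1_mx m (fun x => Q' x - Q x).
  by apply: pCmB; exact: pC1_Q.
have b1 := bgrad _ (fun k => bcm_pd k (pC1_Q QC)).
have b2 := bgrad _ (fun k => bcm_pd k (pC1_Q QC')).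
have b3 := bgrad _ (fun k => bcm_pd k dQC).
have h1 := bcM bK b1; have h2 := bcM bK b2; have h3 := bcM bK b3.
have hh f : bc f -> bc (fun x => 2^-1 * f x) by move=> bf; solve_bc.
apply: etrans (_ : I _ = _) (etrans (intD hd (bcB (hh _ h2) (hh _ h1)) (hh _ h3))
  (f_equal2 +%R (etrans (intB hd (hh _ h2) (hh _ h1))
     (f_equal2 (fun X Y => X - Y) (intZ hd _ h2) (intZ hd _ h1))) (intZ hd _ h3))).
apply: int_eq => // x /subset_Omega Ox.
by apply: sum_expand => k; rewrite (pdQ k Ox); exact: sqnorm_expand.
Qed.

(** By [sqnorm_expand] the two sides differ by the integral of [W / 2 |Q' - Q|^2], a nonnegative
    dissipation that the final bound does not record. *)
Lemma anchoring_ge :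
  2^-1 * anchoring_energy s' - 2^-1 * anchoring_energy s <=
  I (fun x => coef_W m x * ddot (Q' x - Q_star m x) (Q' x - Q x)).
Proof.
have bW := bc_W hm; have bS := bcm_Qstar hm.
have b1 : bc (fun x => sqnorm (Q' x - Q_star m x)) by apply: bc_ddot; exact: bcmB.
have b2 : bc (fun x => sqnorm (Q x - Q_star m x)) by apply: bc_ddot; exact: bcmB.
have b3 : bc (fun x => ddot (Q' x - Q_star m x) (Q' x - Q x)).
  by apply: bc_ddot; exact: bcmB.
rewrite /anchoring_energy -!(intZ hd); [|solve_bc..].
rewrite -(intB hd); [|solve_bc..].
apply: (le_int hd); [solve_bc..|] => x /subset_Omega Ox.
have W0 : 0 <= coef_W m x.
  by case: hm => _ _ _ /(_ x Ox)[_ _ _ _ []].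
have -> : Q' x - Q x = (Q' x - Q_star m x) - (Q x - Q_star m x).
  by rewrite opprB addrA subrK.
rewrite sqnorm_expand -subr_ge0; set e := (X in 0 <= X).
have -> : e = 2^-1 * (coef_W m x * sqnorm (Q' x - Q_star m x - (Q x - Q_star m x))).
  by rewrite /e; ring.
apply: mulr_ge0; first by [].
by apply: mulr_ge0; [exact: W0|exact: sqnorm_ge0].
Qed.

Lemma E_BDF1_split (u : state R d) :
  C2 m (vel u) -> C2 m (Qten u) ->
  E_BDF1 m u = 2^-1 * I (fun x => sqnorm (vel u x)) +
    2^-1 * elastic_energy u + 2^-1 * anchoring_energy u + F_bulk m (Qten u).
Proof.
move=> uC uQC.
have bK := partially_C1_bc (pC1_K hm); have bW := bc_W hm.
have b1 : bc (fun x => sqnorm (vel u x)) by apply: bc_ddot; exact: bcm_vel.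
have b2 : bc (fun x => \sum_k sqnorm (pd k (Qten u) x)).
  have bdQ k := bcm_pd k (pC1_Q uQC).
  exact: (bc_sum _ (fun k => bc_ddot (bdQ k) (bdQ k))).
have b3 : bc (fun x => sqnorm (Qten u x - Q_star m x)).
  by apply: bc_ddot; apply: bcmB; [exact: bcm_Q|exact: bcm_Qstar
    |exact: bcm_Q|exact: bcm_Qstar].
rewrite /E_BDF1 /elastic_energy /anchoring_energy; congr (_ + _).
rewrite -!(intZ hd); [|solve_bc..].
rewrite -!(intD hd); [|solve_bc..].
by apply: int_eq => // x _; ring.
Qed.

Let sqr_normL2_sqrt (p q : nat) (c : 'rV[R]_d -> R) (P : 'rV[R]_d -> 'M[R]_(p, q)) :
  (forall x, closed_Omega m x -> 0 <= c x) ->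
  normL2 m (fun x => Num.sqrt (c x) *: P x) ^+ 2 =
  I (fun x => c x * sqnorm (P x)).
Proof.
move=> c0; rewrite sqr_normL2//; apply: int_eq => // x /subset_Omega /c0 cx0.
by rewrite /sqnorm !ddotEs mulrA -expr2 sqr_sqrtr.
Qed.

Let sqr_normL2_3_sqrt (p q : nat) (c : 'rV[R]_d -> R)
    (T : 'I_d -> 'rV[R]_d -> 'M[R]_(p, q)) :
  (forall x, closed_Omega m x -> 0 <= c x) ->
  normL2_3 m (fun k x => Num.sqrt (c x) *: T k x) ^+ 2 =
  I (fun x => c x * \sum_k sqnorm (T k x)).
Proof.
move=> c0; rewrite sqr_sqrtr; last first.
  by apply: (int_ge0 hd) => x _; apply: sumr_ge0 => k _; exact: sqnorm_ge0.
apply: int_eq => // x /subset_Omega /c0 cx0; rewrite mulr_sumr.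
by apply: eq_bigr => k _; rewrite /sqnorm !ddotEs mulrA -expr2 sqr_sqrtr.
Qed.

Lemma energy_step (M : R) : 0 < kappa ->
  (forall x, closed_Omega m x -> tnorm (Q x) <= M) ->
  (forall x, closed_Omega m x -> tnorm (Q' x) <= M) ->
  convex_function (M0_fields_bounded_by m M) (F_kappa m kappa) ->
  E_BDF1 m s' - E_BDF1 m s <=
    - (2 * tau * normL2 m (fun x => Num.sqrt (coef_eta m x) *: D' x) ^+ 2)
    - tau * normL2 m (fun x => Num.sqrt (coef_b m x) *: v' x) ^+ 2
    - tau * normL2 m (fun x => Num.sqrt (coef_Gamma m x) *: H' x) ^+ 2
    - 2^-1 * normL2 m (fun x => v' x - v x) ^+ 2
    - 2^-1 * normL2_3 m (fun k x => Num.sqrt (coef_K m x) *: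
        pd k (fun y => Q' y - Q y) x) ^+ 2
    + tau * inner m Q (fun x => coef_chi m x *: D' x - coef_xi m x *: H' x).
Proof.
move=> kappa0 QM QM' cvx.
have coef0 x : closed_Omega m x -> [/\ 0 <= coef_b m x, 0 <= coef_eta m x,
    0 <= coef_K m x & 0 <= coef_Gamma m x].
  by move=> Ox; case: hm => _ _ _ /(_ x Ox)[].
have MQ : M0_fields_bounded_by m M Q.
  by split=> // x Ox; split; [exact: M0Q|exact: QM].
have MQ' : M0_fields_bounded_by m M Q'.
  by split=> // x Ox; split; [exact: M0Q'|exact: QM'].
have ipE : inner m Q (fun x => coef_chi m x *: D' x - coef_xi m x *: H' x) =
    I (fun x => coef_chi m x * ddot (Q x) (D' x)) -
    I (fun x => coef_xi m x * ddot (Q x) (H' x)).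
  have bchi := partially_C1_bc (pC1_chi hm); have bxi := partially_C1_bc (pC1_xi hm).
  have b1 : bc (fun x => ddot (Q x) (D' x)) by exact: bc_ddot.
  have b2 : bc (fun x => ddot (Q x) (H' x)) by exact: bc_ddot.
  apply: etrans (_ : I _ = _) (intB hd (bcM bchi b1) (bcM bxi b2)).
  by apply: int_eq => // x _; rewrite ddotDr ddotNr !ddotZr.
have N0 : 0 <= kappa / 2 * I (fun x => sqnorm (Q' x - Q x)).
  apply: mulr_ge0; first by rewrite divr_ge0// ltW.
  by apply: (int_ge0 hd) => x _; exact: sqnorm_ge0.
have cancel : z * (inner m (g_v s') (c_v m s) + inner m (G_Q s') (C_Q m s)) =
    w * (inner m (g_v s') (g_v s) + inner m (G_Q s') (G_Q s)).
  have swap (x y g : R) : x / g * y = y / g * x by rewrite mulrAC (mulrC x) mulrAC.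
  by case: step => _ -> ->; exact: swap.
have nEta := sqr_normL2_sqrt D' (fun x Ox => let: And4 _ h _ _ := coef0 x Ox in h).
have nb := sqr_normL2_sqrt v' (fun x Ox => let: And4 h _ _ _ := coef0 x Ox in h).
have nGam := sqr_normL2_sqrt H' (fun x Ox => let: And4 _ _ _ h := coef0 x Ox in h).
have nK := sqr_normL2_3_sqrt (fun k => pd k (fun y => Q' y - Q y))
  (fun x Ox => let: And4 _ _ h _ := coef0 x Ox in h).
have nV := sqr_normL2 m hd (fun x => v' x - v x).
exact: (energy_arithmetic (E_BDF1_split vC' QC') (E_BDF1_split vC QC)
  momentum_balance tensor_balance elastic_balance elastic_identity anchoring_ge
  (bulk_energy_le hm hd cvx MQ MQ') N0 cancel nEta nb nGam nV nK ipE).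
Qed.

End EnergyBalance.

(** In the Dirichlet case both time levels take the same value [QD] on the face. In the Neumann case
    [pd k] is, up to sign, the normal derivative there. *)
Lemma boundary_conditions_faces (R : realType) (d : nat) (m : model R d)
    (hm : model_assumptions m) (Nt : nat) (u : nat -> state R d) (n : nat) :
  (n < Nt)%N -> boundary_conditions m Nt u -> C2 m (Qten (u n.+1)) ->
  forall i j k, vanishes_on_faces m k (fun x => coef_K m x *
    pd k (fun y => Qten (u n.+1) y i j) x *
    (Qten (u n.+1) x i j - Qten (u n) x i j)).
Proof.
have s0 : 0 < side m by case: hm => -[].
move=> nNt [_ bcQ] [[U [_ OU QU]] _] i j k x xi xk.
have bdx := face_bd_Omega s0 xi xk.
case: bcQ => [[QD _ QE]|nQ].
  by rewrite (QE n.+1)// (QE n) ?(ltnW nNt)// subrr mulr0.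
have [dQ _] := QU x (OU x bdx.1).
have pd0 : pd k (Qten (u n.+1)) x = 0.
  case: xk => xk; last first.
    by apply: (nQ n.+1 x (delta_mx 0 k)) => //; exists k => //; left.
  (* On the lower face the outward normal is minus the basis vector; differentiability makes the
     directional derivative odd in its direction. *)
  have := nQ n.+1 x (- delta_mx 0 k) nNt
    (ex_intro2 _ _ k xi (or_intror (conj xk erefl))).
  by rewrite /pd !deriveE// linearN => /eqP; rewrite oppr_eq0 => /eqP.
by rewrite -(pd_entry_diff k i j dQ) pd0 mxE mulr0 mul0r.
Qed.

Theorem theorem3p2 (R : realType) (d : nat) (hd : d = 2%N \/ d = 3%N)
    (m : model R d) (hm : model_assumptions m)
    (Nt : nat) (tau kappa M : R)
    (htau : 0 < tau) (hkappa : 0 < kappa) (hM : 0 < M)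
    (u : nat -> state R d) (zeta omega : nat -> R)
    (hu : SGE_BDF1 m Nt tau kappa u zeta omega)
    (hQM : forall n x, (n <= Nt)%N -> closed_Omega m x ->
       tnorm (Qten (u n) x) <= M)
    (hconvex : convex_function (M0_fields_bounded_by m M) (F_kappa m kappa)) :
  (forall n, (n < Nt)%N ->
     E_BDF1 m (u n.+1) - E_BDF1 m (u n) <=
       - (2 * tau * normL2 m (fun x =>
             Num.sqrt (coef_eta m x) *: symgrad (vel (u n.+1)) x) ^+ 2)
       - tau * normL2 m (fun x => Num.sqrt (coef_b m x) *: vel (u n.+1) x) ^+ 2
       - tau * normL2 m (fun x => Num.sqrt (coef_Gamma m x) *: Hten (u n.+1) x) ^+ 2
       - 2^-1 * normL2 m (fun x => vel (u n.+1) x - vel (u n) x) ^+ 2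
       - 2^-1 * normL2_3 m (fun k x => Num.sqrt (coef_K m x) *:
             pd k (fun y => Qten (u n.+1) y - Qten (u n) y) x) ^+ 2
       + tau * inner m (Qten (u n)) (fun x =>
             coef_chi m x *: symgrad (vel (u n.+1)) x - coef_xi m x *: Hten (u n.+1) x))
  /\
  ((forall x, closed_Omega m x -> coef_chi m x = 0 /\ coef_xi m x = 0) ->
   forall n, (n < Nt)%N -> E_BDF1 m (u n.+1) <= E_BDF1 m (u n)).
Proof.
have step_le := fun n (nNt : (n < Nt)%N) =>
  let: And5 reg preg bcs _ steps := hu in
  let: And4 vC QC HC M0Q := reg n (ltnW nNt) in
  let: And4 vC' QC' HC' M0Q' := reg n.+1 nNt in
  energy_step hm hd htau vC QC HC vC' QC' HC' (preg n nNt) M0Q M0Q'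
    (fun x => bcs.1 n.+1 x nNt) (steps n nNt).2
    (boundary_conditions_faces hm nNt bcs QC') hkappa
    (fun x => hQM n x (ltnW nNt)) (fun x => hQM n.+1 x nNt) hconvex.
split=> // passive n nNt; rewrite -subr_le0; apply: le_trans (step_le n nNt) _.
have -> : inner m (Qten (u n)) (fun x => coef_chi m x *: symgrad (vel (u n.+1)) x -
    coef_xi m x *: Hten (u n.+1) x) = 0.
  apply: etrans (int0 m hd); apply: int_eq => // x /subset_Omega /passive[-> ->].
  (* The zero matrix is written as a multiple by 0 so that homogeneity of [ddot] applies. *)
  by rewrite !scale0r subr0 -(scale0r 0) ddotZr mul0r.
rewrite mulr0 addr0 -!opprD oppr_le0.
have h0 : 0 <= 2^-1 :> R by [].
have tau2 : 0 <= 2 * tau by rewrite mulr_ge0// ltW.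
do 4?[apply: addr_ge0; last by apply: mulr_ge0; rewrite ?sqr_ge0// ltW].
by apply: mulr_ge0; rewrite ?sqr_ge0// ltW.
Qed.
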